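(* Let $k,n,d\in\mathbb{N}$ with $k\le d$, and let $\lambda$ be a partition of size $kn$ with at most $k$ parts. Then the irreducible $\mathrm{GL}_d(\mathbb{C})$-representation $\mathscr{V}_{2\lambda}$ of highest weight $2\lambda$ occurs in the plethysm $\mathrm{Sym}^k(\mathrm{Sym}^{2n}\mathbb{C}^d)$, i.e., $\mathrm{Sym}^k(\mathrm{Sym}^{2n}\mathbb{C}^d)$ has a $\mathrm{GL}_d(\mathbb{C})$-submodule isomorphic to $\mathscr{V}_{2\lambda}$.
   Context: For $\mu\in\mathbb{Z}^d$ with $\mu_1\ge\cdots\ge\mu_d$, $\mathscr{V}_\mu$ denotes the irreducible rational $\mathrm{GL}_d(\mathbb{C})$-module of highest weight $\mu$ (with respect to the Borel subgroup of upper triangular matrices). A partition $\lambda$ with at most $k\le d$ parts is identified with the vector $(\lambda_1,\ldots,\lambda_d)\in\mathbb{N}^d$, $\lambda_1\ge\cdots\ge\lambda_d\geq 0$, where $\lambda_i=0$ for $i>k$; its size is $|\lambda|=\sum_i\lambda_i$, and $2\lambda=(2\lambda_1,\ldots,2\lambda_d)$. $\mathrm{Sym}^{2n}\mathbb{C}^d$ is the space of vectors of $(\mathbb{C}^d)^{\otimes 2n}$ invariant under the permutation action of the symmetric group on the tensor factors, with the natural $\mathrm{GL}_d(\mathbb{C})$-action; $\mathrm{Sym}^k(\mathrm{Sym}^{2n}\mathbb{C}^d)$ is the $k$-th symmetric power of this representation. *)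

(* Defs.v *)
From HB Require Import structures.
From mathcomp Require Import all_boot all_order all_fingroup all_algebra.
From mathcomp Require Import complex reals.
From mathcomp Require mpoly.

Set Implicit Arguments.
Unset Strict Implicit.
Unset Printing Implicit Defensive.

Import GRing.Theory.
Local Open Scope ring_scope.

(* Finite-dimensional representations of GL_d(C). The group is the set unitmx
   of invertible d x d matrices; the value of the action at a singular matrix
   carries no information, and no definition below depends on it. *)
Record glrep (C : fieldType) (d : nat) := GLRep {
  glspace :> vectType C;
  glact : 'M[C]_d -> 'End(glspace);
  glact1 : glact 1%:M = \1%VF;
  glactM : {in unitmx &, forall g h,
              glact (g *m h) = (glact g \o glact h)%VF} }.

Section Representations.
Context {C : fieldType} {d : nat}.
Implicit Types V W : glrep C d.

Definition glstable W (U : {vspace W}) : Prop :=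
  forall g : 'M[C]_d, g \in unitmx -> (glact W g @: U <= U)%VS.

Definition gl_irreducible V : Prop :=
  {:V}%VS <> 0%VS /\
  forall U : {vspace V}, glstable U -> U = 0%VS \/ U = {:V}%VS.

(* The matrix coefficients are polynomials in the entries of g and 1 / det g. *)
Definition gl_rational V : Prop :=
  forall i j : 'I_(\dim {:V}),
  exists (p : mpoly.mpoly (d * d) C) (N : nat),
  forall g : 'M[C]_d, g \in unitmx ->
    coord (vbasis {:V}) i (glact V g (vbasis {:V})`_j) =
    mpoly.meval (fun l => mxvec g 0 l) p / \det g ^+ N.

Definition upper_triangular (b : 'M[C]_d) : Prop :=
  forall i j : 'I_d, (j < i)%N -> b i j = 0.

Definition highest_weight_vector V (mu : 'I_d -> int) (v : V) : Prop :=
  v <> 0 /\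
  forall b : 'M[C]_d, b \in unitmx -> upper_triangular b ->
    glact V b v = (\prod_(i < d) b i i ^ mu i) *: v.

(* V is a model of the irreducible rational module of highest weight mu. *)
Definition irreducible_of_highest_weight (mu : 'I_d -> int) V : Prop :=
  [/\ gl_rational V, gl_irreducible V &
      exists v : V, highest_weight_vector mu v].

Definition gl_isomorphic V W : Prop :=
  exists f : 'Hom(V, W), bijective f /\
  forall g : 'M[C]_d, g \in unitmx ->
    (f \o glact V g)%VF = (glact W g \o f)%VF.

Section Subrepresentation.
Variables (W : glrep C d) (U : {vspace W}) (sU : glstable U).

Definition subact (g : 'M[C]_d) : 'End(subvs_of U) :=
  linfun (vsproj U \o (glact W g \o vsval)).

Lemma subactE g (u : subvs_of U) :
  g \in unitmx -> vsval (subact g u) = glact W g (vsval u).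
Proof.
move=> gU; rewrite lfunE /= vsprojK //.
exact/(subvP (sU gU))/memv_img/subvsP.
Qed.

Lemma subact1 : subact 1%:M = \1%VF.
Proof.
apply/lfunP => u; apply: (can_inj vsvalK).
by rewrite subactE ?unitmx1 // glact1 !id_lfunE.
Qed.

Lemma subactM :
  {in unitmx &, forall g h, subact (g *m h) = (subact g \o subact h)%VF}.
Proof.
move=> g h gU hU; apply/lfunP => u; apply: (can_inj vsvalK).
rewrite comp_lfunE /= !subactE ?unitmx_mul ?gU ?hU //.
by rewrite glactM // comp_lfunE.
Qed.

Definition subrep : glrep C d := GLRep subact1 subactM.

End Subrepresentation.

Definition occurs_in V W : Prop :=
  exists (U : {vspace W}) (sU : glstable U), gl_isomorphic V (subrep sU).

End Representations.

(* The m-th tensor power of V, in the basis e_I = e_(I 0) (x) ... (x) e_(I m-1)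
   indexed by the words I, where e = vbasis {:V}: T stands for
   \sum_I T I *: e_I. *)
Definition tensors (C : fieldType) (V : vectType C) (m : nat) :=
  {ffun {ffun 'I_m -> 'I_(\dim {:V})} -> C^o}.

Section TensorPower.
Context {C : fieldType} {V : vectType C} {m : nat}.
Local Notation e := (vbasis {:V}).
Local Notation word := {ffun 'I_m -> 'I_(\dim {:V})}.

(* f (x) ... (x) f, through f e_i = \sum_j coord e j (f e_i) *: e_j. *)
Definition tensor_fun (f : 'End(V)) (T : tensors V m) : tensors V m :=
  [ffun J : word =>
    \sum_(I : word) (\prod_(a < m) coord e (J a) (f e`_(I a))) * T I].

Lemma tensor_fun_linear f : linear (tensor_fun f).
Proof.
move=> c S T; apply/ffunP => J; rewrite !ffunE scaler_sumr -big_split.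
by apply: eq_bigr => I _; rewrite !ffunE mulrDr /= mulrCA.
Qed.

HB.instance Definition _ f :=
  GRing.isLinear.Build C (tensors V m) (tensors V m) _ (tensor_fun f)
    (tensor_fun_linear f).

Definition tensor_map (f : 'End(V)) : 'End(tensors V m) :=
  linfun (tensor_fun f).

(* s moves the tensor factors: (perm_fun s T) J = T (J \o s). *)
Definition perm_fun (s : 'S_m) (T : tensors V m) : tensors V m :=
  [ffun J : word => T [ffun a => J (s a)]].

Lemma perm_fun_linear s : linear (perm_fun s).
Proof. by move=> c S T; apply/ffunP => J; rewrite !ffunE. Qed.

HB.instance Definition _ s :=
  GRing.isLinear.Build C (tensors V m) (tensors V m) _ (perm_fun s)
    (perm_fun_linear s).

Definition perm_map (s : 'S_m) : 'End(tensors V m) := linfun (perm_fun s).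

Definition symmetric_tensors : {vspace tensors V m} :=
  (\bigcap_(s : 'S_m) fixedSpace (perm_map s))%VS.

Lemma symmetric_tensorsP T :
  reflect (forall s, perm_fun s T = T) (T \in symmetric_tensors).
Proof.
apply: (iffP idP) => [Tsym s | Tsym].
  have /subvP/(_ T Tsym)/fixedSpaceP :
    (symmetric_tensors <= fixedSpace (perm_map s))%VS by apply: bigcapv_inf.
  by rewrite lfunE.
rewrite memvE; apply/subv_bigcapP => s _; rewrite -memvE.
by apply/fixedSpaceP; rewrite lfunE /= Tsym.
Qed.

Lemma tensor_map1 : tensor_map \1%VF = \1%VF.
Proof.
apply/lfunP => T; rewrite lfunE id_lfunE /=; apply/ffunP => J; rewrite ffunE.
have fe := basis_free (vbasisP {:V}).
rewrite (bigD1 J) //= big1 ?mul1r => [|a _]; last first.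
  by rewrite id_lfunE coord_free // eqxx.
rewrite big1 ?addr0 // => I neqIJ.
have [a neqa] : exists a, I a != J a.
  apply/existsP; apply: contraR neqIJ; rewrite negb_exists => /forallP eqIJ.
  by apply/eqP/ffunP => a; apply/eqP; have := eqIJ a; rewrite negbK.
rewrite (bigD1 a) //= id_lfunE coord_free //.
by rewrite (negbTE neqa) !mul0r.
Qed.

Lemma tensor_mapM f g :
  tensor_map (f \o g)%VF = (tensor_map f \o tensor_map g)%VF.
Proof.
apply/lfunP => T; rewrite comp_lfunE !lfunE /=; apply/ffunP => J.
rewrite !ffunE.
under [RHS]eq_bigr => K _ do rewrite ffunE mulr_sumr.
rewrite exchange_big /=; apply: eq_bigr => I _.
under [RHS]eq_bigr => K _ do rewrite mulrA -big_split /=.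
rewrite -mulr_suml; congr (_ * _).
rewrite -(bigA_distr_bigA
  (fun (a : 'I_m) (k : 'I_(\dim {:V})) =>
     coord e (J a) (f e`_k) * coord e k (g e`_(I a)))) /=.
apply: eq_bigr => a _; rewrite comp_lfunE.
rewrite {1}(coord_vbasis (memvf (g e`_(I a)))) !linear_sum /=.
by apply: eq_bigr => k _; rewrite !linearZ /= mulrC.
Qed.

Lemma tensor_map_perm f s T :
  tensor_fun f (perm_fun s T) = perm_fun s (tensor_fun f T).
Proof.
apply/ffunP => J; rewrite !ffunE.
pose h (I : word) := [ffun a => I ((s^-1)%g a)].
rewrite (reindex h) /=; last first.
  exists (fun I : word => [ffun a => I (s a)]);
    by move=> I _; apply/ffunP => a; rewrite !ffunE ?permK ?permKV.
apply: eq_bigr => I _; rewrite !ffunE; congr (_ * T _); last first.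
  by apply/ffunP => a; rewrite !ffunE permK.
rewrite (reindex_inj (@perm_inj _ s)) /=.
by apply: eq_bigr => a _; rewrite !ffunE permK.
Qed.

End TensorPower.

Section Constructions.
Context {C : fieldType} {d : nat}.

Definition std_act (g : 'M[C]_d) : 'End('cV[C]_d) := linfun (mulmx g).

Lemma std_act1 : std_act 1%:M = \1%VF.
Proof. by apply/lfunP => v; rewrite lfunE id_lfunE /= mul1mx. Qed.

Lemma std_actM :
  {in unitmx &, forall g h, std_act (g *m h) = (std_act g \o std_act h)%VF}.
Proof.
by move=> g h _ _; apply/lfunP => v; rewrite comp_lfunE !lfunE /= mulmxA.
Qed.

Definition std_rep : glrep C d := GLRep std_act1 std_actM.

Section Powers.
Variables (m : nat) (V : glrep C d).

Definition tensor_act (g : 'M[C]_d) : 'End(tensors V m) :=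
  tensor_map (glact V g).

Lemma tensor_act1 : tensor_act 1%:M = \1%VF.
Proof. by rewrite /tensor_act glact1 tensor_map1. Qed.

Lemma tensor_actM :
  {in unitmx &, forall g h,
     tensor_act (g *m h) = (tensor_act g \o tensor_act h)%VF}.
Proof. by move=> g h gU hU; rewrite /tensor_act glactM // tensor_mapM. Qed.

Definition tensor_power : glrep C d := GLRep tensor_act1 tensor_actM.

Lemma symmetric_tensors_stable :
  @glstable C d tensor_power symmetric_tensors.
Proof.
move=> g gU; apply/subvP => _ /memv_imgP [T /symmetric_tensorsP Tsym ->].
apply/symmetric_tensorsP => s; rewrite lfunE /=.
by rewrite -tensor_map_perm Tsym.
Qed.

Definition sym_power : glrep C d := subrep symmetric_tensors_stable.

End Powers.

End Constructions.

Arguments std_rep : clear implicits.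

Definition is_partition (lam : seq nat) : bool :=
  sorted geq lam && (0%N \notin lam).

(* The vector (2 lam_1, ..., 2 lam_d), where lam is padded with zeros. *)
Definition double_weight (d : nat) (lam : seq nat) : 'I_d -> int :=
  fun i => Posz (2 * nth 0 lam i)%N.

Arguments double_weight : clear implicits.

(* Main.v *)
From HB Require Import structures.
Require Import Defs.
From mathcomp Require Import all_boot all_order all_fingroup all_algebra.
From mathcomp Require Import complex reals boolp.
From mathcomp Require Import mpoly.

Set Implicit Arguments.
Unset Strict Implicit.
Unset Printing Implicit Defensive.

Import Order.TTheory GRing.Theory Num.Theory.
Local Open Scope ring_scope.

(** Fill the Young diagram of lam column by column with 1, ..., k, 1, ..., k,
    and so on: a column has at most k boxes, so its entries are distinct, and
    each entry occurs n times. Doubling every column of this tableau gives a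
    vector w of weight 2 lam in Sym^k(Sym^2n C^d), the symmetrisation of a
    product of determinants, one for each column. Its pairing with the k-th
    power of \sum_j x_j^(2n), for real x_j, is the sum over all maps phi of
    {1, ..., k} to itself of the squares of the products, over the columns of
    lam, of the determinants of the x_(phi(entry)). For phi = id and x_j on the
    moment curve these are Vandermonde determinants, so w <> 0.

    The module generated by w is irreducible: the orthogonal projection of w to
    a submodule, for the standard Hermitian product, again has weight 2 lam, and
    in a cyclic module generated by a highest weight vector the vectors of that
    weight on which the unipotent upper triangular matrices act trivially form
    a line. The same line argument, applied to the submodule of V + U generated
    by the pair of highest weight vectors, identifies any two irreducible
    rational modules V and U with the same highest weight. *)

(** * Rational functions on GL_d *)

Lemma horner_eq0 (F : numDomainType) (p : {poly F}) :
  (forall z, p.[z] = 0) -> p = 0.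
Proof.
move=> p0; apply/eqP/negP => /negP pn0.
have := @max_poly_roots F p [seq i%:R | i <- iota 0 (size p)] pn0.
rewrite size_map size_iota ltnn => H; suff: false by [].
apply: H; first by apply/allP => x _; apply/eqP.
by rewrite map_inj_uniq ?iota_uniq // => i j /eqP; rewrite eqr_nat => /eqP.
Qed.

(** A nonzero [p] has only finitely many roots. This is the density argument that extends to every
    point an identity known only at generic points. *)
Lemma horner_eq0_generic (F : numDomainType) (p q : {poly F}) :
  p != 0 -> (forall z, p.[z] != 0 -> q.[z] = 0) -> q = 0.
Proof.
move=> pn0 pq; suff /eqP : p * q = 0.
  by rewrite mulf_eq0 (negbTE pn0) => /eqP.
apply: horner_eq0 => z; rewrite hornerM.
by case: (eqVneq p.[z] 0) => [->|/pq ->]; rewrite ?mul0r ?mulr0.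
Qed.

Section RationalFunctions.
Variables (C : fieldType) (d : nat).

Definition ratfun (F : 'M[C]_d -> C) : Prop :=
  exists (p : mpoly.mpoly (d * d) C) (N : nat),
  forall g : 'M[C]_d, g \in unitmx ->
    F g = mpoly.meval (fun l => mxvec g 0 l) p / \det g ^+ N.

Lemma eq_ratfun F G : F =1 G -> ratfun F -> ratfun G.
Proof. by move=> FG [p [N pN]]; exists p, N => g /pN <-. Qed.

(** The generic matrix. Its determinant supplies, as polynomials, the powers of [\det g] that bring
    two fractions to a common denominator. *)
Definition mpoly_mx : 'M[mpoly.mpoly (d * d) C]_d :=
  \matrix_(i, j) mpoly.mpolyX C (mpoly.mnm1 (mxvec_index i j)).

Lemma meval_mpoly_mx g :
  map_mx (mpoly.meval (fun l => mxvec g 0 l)) mpoly_mx = g.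
Proof. by apply/matrixP => i j; rewrite !mxE mpoly.mevalXU mxvecE. Qed.

Lemma ratfun_cst c : ratfun (fun=> c).
Proof.
by exists (mpoly.mpolyC _ c), 0 => g _; rewrite mpoly.mevalC expr0 divr1.
Qed.

Lemma ratfun_entry i j : ratfun (fun g => g i j).
Proof.
by exists (mpoly_mx i j), 0 => g _; rewrite -{1}(meval_mpoly_mx g) mxE divr1.
Qed.

Lemma ratfunD F G : ratfun F -> ratfun G -> ratfun (fun g => F g + G g).
Proof.
move=> [p [N pN]] [q [M qM]].
exists (p * \det mpoly_mx ^+ M + q * \det mpoly_mx ^+ N), (N + M) => g gU.
have det0 : \det g != 0 by rewrite -unitfE.
rewrite pN // qM // mpoly.mevalD !mpoly.mevalM !rmorphXn /= -!det_map_mx.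
rewrite !meval_mpoly_mx exprD addf_div ?expf_neq0 //.
Qed.

Lemma ratfunM F G : ratfun F -> ratfun G -> ratfun (fun g => F g * G g).
Proof.
move=> [p [N pN]] [q [M qM]]; exists (p * q), (N + M) => g gU.
by rewrite pN // qM // mpoly.mevalM exprD mulf_div.
Qed.

Lemma ratfun_sum (I : Type) (r : seq I) (F : I -> 'M[C]_d -> C) :
  (forall i, ratfun (F i)) -> ratfun (fun g => \sum_(i <- r) F i g).
Proof.
move=> rF; elim: r => [|i r IHr].
  by apply: eq_ratfun (ratfun_cst 0) => g; rewrite big_nil.
by apply: eq_ratfun (ratfunD (rF i) IHr) => g; rewrite big_cons.
Qed.

Lemma ratfun_prod (I : Type) (r : seq I) (F : I -> 'M[C]_d -> C) :
  (forall i, ratfun (F i)) -> ratfun (fun g => \prod_(i <- r) F i g).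
Proof.
move=> rF; elim: r => [|i r IHr].
  by apply: eq_ratfun (ratfun_cst 1) => g; rewrite big_nil.
by apply: eq_ratfun (ratfunM (rF i) IHr) => g; rewrite big_cons.
Qed.

Definition evalmx (A : 'M[{poly C}]_d) (z : C) : 'M[C]_d :=
  map_mx (horner_eval z) A.

(** Substituting the entries of [A] into the numerator gives [q]. Along a polynomial curve of
    matrices, questions on rational functions thus become questions on polynomials in one
    variable. *)
Lemma ratfun_path F (A : 'M[{poly C}]_d) : ratfun F ->
  exists (q : {poly C}) (N : nat), forall z, evalmx A z \in unitmx ->
    F (evalmx A z) * \det (evalmx A z) ^+ N = q.[z].
Proof.
move=> [p [N pN]].
exists (mpoly.mmap polyC (fun l => mxvec A 0 l) p), N => z AU.
rewrite pN // divfK; last by rewrite expf_neq0 // -unitfE.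
rewrite mpoly.mevalE /mpoly.mmap -[RHS]/(horner_eval z _) raddf_sum /=.
apply: eq_bigr => m _; rewrite rmorphM /= /horner_eval hornerC; congr (_ * _).
rewrite /mpoly.mmap1 horner_prod; apply: eq_bigr => i _.
rewrite horner_exp; congr (_ ^+ _).
by case/mxvec_indexP: i => i j; rewrite !mxvecE mxE.
Qed.

End RationalFunctions.

(** * Factorisation of generic matrices *)

Definition lower_unitriangular (F : fieldType) d (l : 'M[F]_d) : bool :=
  is_trig_mx l && [forall i, l i i == 1].

Lemma det_lower_unitriangular (F : fieldType) d (l : 'M[F]_d) :
  lower_unitriangular l -> \det l = 1.
Proof.
case/andP => /det_trig -> /forallP l1.
by rewrite big1 // => i _; apply/eqP.
Qed.

Lemma lower_unitriangular_unit (F : fieldType) d (l : 'M[F]_d) :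
  lower_unitriangular l -> l \in unitmx.
Proof. by move=> /det_lower_unitriangular l1; rewrite unitmxE l1 unitr1. Qed.

Lemma char_poly_oppE (F : fieldType) d (g : 'M[F]_d) z :
  (char_poly (- g)).[z] = \det (g + z%:M).
Proof.
rewrite -[LHS]/(horner_eval z _) -det_map_mx; congr (\det _).
apply/matrixP => i j; rewrite !mxE /= /horner_eval hornerD hornerN hornerMn.
by rewrite hornerX hornerC opprK addrC.
Qed.

(** Here [p] is the product of the leading principal minors of [g + z%:M]; each is a characteristic
    polynomial in z, hence monic. The induction splits off the last row and column, and [s] is the
    Schur complement of the leading block. *)
Lemma LU_generic (F : fieldType) d (g : 'M[F]_d) :
  exists2 p : {poly F}, p != 0 & forall z, p.[z] != 0 ->
    exists l u, [/\ lower_unitriangular l, upper_triangular u, u \in unitmx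
                  & g + z%:M = l *m u].
Proof.
elim: d => [|d IHd] in g *.
  exists 1 => [|z _]; first exact: oner_neq0.
  exists 1%:M, 1%:M; rewrite unitmx1 mul1mx; split => //.
  - by apply/andP; split; [apply/is_trig_mxP|apply/forallP]; case.
  - by case.
  - by apply/matrixP; case.
rewrite -addn1 in g *.
have [p pn0 pP] := IHd (ulsubmx g).
exists (p * char_poly (- g)) => [|z].
  by rewrite mulf_neq0 // monic_neq0 // char_poly_monic.
rewrite hornerM mulf_eq0 negb_or char_poly_oppE => /andP [/pP].
move=> [L [U [Llow Uup Uunit LU]]] detg.
have Lunit := lower_unitriangular_unit Llow.
pose c := dlsubmx g; pose b := ursubmx g.
pose s := drsubmx g + z%:M - c *m invmx U *m (invmx L *m b).
pose l : 'M_(d + 1) := block_mx L 0 (c *m invmx U) 1%:M.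
pose u : 'M_(d + 1) := block_mx U (invmx L *m b) 0 s.
have gE : g + z%:M = l *m u.
  rewrite -{1}[g]submxK scalar_mx_block add_block_mx LU !addr0.
  rewrite mulmx_block !mulmx0 !mul0mx !addr0 mul1mx mulmxA mulmxV // mul1mx.
  by rewrite mulmxKV // /s addrCA subrr addr0.
exists l, u; split => //.
- case/andP: Llow => Ltrig /forallP L1; apply/andP; split.
    rewrite is_trig_block_mx // Ltrig eqxx /=.
    by apply/is_trig_mxP => i j; rewrite !ord1.
  apply/forallP => i; rewrite -(splitK i); case: (split i) => {}i /=.
    by rewrite block_mxEul.
  by rewrite block_mxEdr mxE eqxx.
- move=> i j; rewrite -(splitK i) -(splitK j).
  case: (split i) (split j) => {}i [] {}j /=.
  + by rewrite block_mxEul; apply: Uup.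
  + by rewrite ltnNge (leq_trans (ltnW (ltn_ord i))) ?leq_addr.
  + by rewrite block_mxEdl mxE.
  + by rewrite !ord1 ltnn.
- have : l *m u \in unitmx by rewrite -gE unitmxE unitfE.
  by rewrite unitmx_mul => /andP [].
Qed.

(** * Cyclic modules on a highest weight vector *)

Section Functionals.
Variables (F : fieldType) (V : vectType F).

(** A list in [P] whose span has maximal dimension will do. It replaces the span of an infinite
    orbit by the span of a finite list. *)
Lemma span_of_pred (P : V -> Prop) :
  exists2 X : seq V, {in X, forall x, P x} & forall x, P x -> x \in <<X>>%VS.
Proof.
pose Q n := exists X : seq V,
  {in X, forall x, P x} /\ \dim <<X>>%VS = n.
have Q0 : exists n, `[< Q n >].
  by exists 0; apply/asboolP; exists [::]; rewrite span_nil dimv0; split.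
have Qmax n : `[< Q n >] -> (n <= \dim {:V})%N.
  by move=> /asboolP [X [_ <-]]; apply/dimvS/subvf.
case: (ex_maxnP Q0 Qmax) => n /asboolP [X [PX dX]] max_n.
exists X => // x Px; apply/negPn/negP => xnX.
suff /max_n : `[< Q (\dim <<x :: X>>%VS) >].
  rewrite -dX leqNgt => /negP; apply.
  rewrite ltnNge; apply/negP => le_d; case/negP: xnX.
  have sub : (<<X>> <= <<x :: X>>)%VS by rewrite span_cons addvSr.
  have /eqP -> : <<X>>%VS == <<x :: X>>%VS by rewrite eqEdim sub.
  by rewrite memv_span ?mem_head.
apply/asboolP; exists (x :: X); split => // y.
by rewrite inE => /predU1P [->|/PX].
Qed.

Lemma span_ind (X : seq V) (P : V -> Prop) :
  P 0 -> (forall c x y, P x -> P y -> P (c *: x + y)) ->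
  {in X, forall x, P x} -> forall x, x \in <<X>>%VS -> P x.
Proof.
move=> P0 PD PX x /(@coord_span _ _ _ (in_tuple X)) ->.
elim/big_rec: _ => // i y _ Py; apply: PD => //.
by apply: PX; rewrite mem_nth.
Qed.

Lemma functional_sep (U : {vspace V}) (x : V) : x \notin U ->
  exists2 f : 'Hom(V, F^o), {in U, forall y, f y = 0} & f x != 0.
Proof.
move=> xU; pose y := x - projv U x.
have yn0 : y != 0.
  by apply: contraNneq xU => /subr0_eq ->; apply: memv_proj.
have [i ci] : exists i, coord (vbasis {:V}) i y != 0.
  apply/existsP; apply: contraNT yn0 => /existsPn c0.
  rewrite (coord_vbasis (memvf y)) big1 // => i _.
  by have /negPn/eqP -> := c0 i; rewrite scale0r.
exists (linfun (coord (vbasis {:V}) i : V -> F^o) \o (\1 - projv U))%VF.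
  by move=> z zU; rewrite !lfunE /= !lfunE /= !lfunE /= projv_id // subrr linear0.
by rewrite !lfunE /= !lfunE /= !lfunE.
Qed.

Lemma functional_eq (x y : V) :
  (forall f : 'Hom(V, F^o), f x = f y) -> x = y.
Proof.
move=> fxy; apply/eqP; rewrite -subr_eq0; apply/negPn/negP => xy.
have /functional_sep [f _] : x - y \notin 0%VS by rewrite memv0.
by rewrite linearB /= fxy subrr eqxx.
Qed.

End Functionals.

Section Cyclic.
Variables (C : numFieldType) (d : nat).
Implicit Types V W : glrep C d.

Lemma glact_mul V (v : V) : {in unitmx &, forall g h,
  glact V (g *m h) v = glact V g (glact V h v)}.
Proof. by move=> g h gU hU; rewrite glactM // comp_lfunE. Qed.

(** The basis-free form of [gl_rational], which passes to submodules and direct sums without a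
    change of basis. *)
Definition rational_coefs V : Prop :=
  forall (f : 'Hom(V, C^o)) x, ratfun (fun g => f (glact V g x)).

Lemma rational_coefsP V : gl_rational V <-> rational_coefs V.
Proof.
split=> [Vrat f x | Vrat i j]; last first.
  have [p [N pN]] := Vrat (linfun (coord (vbasis {:V}) i : V -> C^o))
                      (vbasis {:V})`_j.
  by exists p, N => g /pN <-; rewrite lfunE.
set e := vbasis {:V}.
suff: ratfun (fun g : 'M[C]_d => \sum_(i < \dim {:V}) \sum_(j < \dim {:V})
          (f e`_i * coord e j x) * coord e i (glact V g e`_j)).
  apply: eq_ratfun => g.
  rewrite {2}(coord_vbasis (memvf x)) !linear_sum exchange_big /=.
  apply: eq_bigr => j _; rewrite !linearZ /=.
  rewrite {2}(coord_vbasis (memvf (glact V g e`_j))) !linear_sum.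
  by apply: eq_bigr => i _; rewrite /= linearZ /= -/e [f _ * _]mulrC -mulrA [f _ * _]mulrC.
apply: ratfun_sum => i; apply: ratfun_sum => j.
by apply: ratfunM (ratfun_cst _ _) _; have [p [N pN]] := Vrat i j; exists p, N.
Qed.

(** Unlike [highest_weight_vector], this admits 0, so that it applies to a projection not yet known
    to be nonzero. *)
Definition weight_vector V (mu : 'I_d -> int) (v : V) : Prop :=
  forall b : 'M[C]_d, b \in unitmx -> upper_triangular b ->
    glact V b v = (\prod_(i < d) b i i ^ mu i) *: v.

Definition cyclic V (v : V) : Prop :=
  forall U : {vspace V}, glstable U -> v \in U -> U = fullv.

(** The span of the orbit is stable and contains [v], so it is everything; [U] itself is not assumed
    stable. *)
Lemma cyclic_span_orbit V (v : V) (U : {vspace V}) : cyclic v ->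
  (forall g, g \in unitmx -> glact V g v \in U) -> U = fullv.
Proof.
move=> vcyc vU.
have [X PX spanX] :=
  span_of_pred (fun x => exists2 g, g \in unitmx & x = glact V g v).
have XU : (<<X>> <= U)%VS by apply/span_subvP => x /PX [g gU ->]; apply: vU.
apply/eqP; rewrite eqEsubv subvf /=; apply: subv_trans XU.
rewrite (vcyc <<X>>%VS) ?subvv //; last first.
  by apply: spanX; exists 1%:M; rewrite ?unitmx1 // glact1 id_lfunE.
move=> g gU; rewrite limg_span; apply/span_subvP => _ /mapP [x /PX [h hU ->] ->].
by apply: spanX; exists (g *m h); rewrite ?unitmx_mul ?gU ?glact_mul.
Qed.

Lemma orbit_span V (v : V) : exists (U : {vspace V}) (sU : glstable U)
  (vU : v \in U), cyclic (vsproj U v : subrep sU).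
Proof.
have [X PX spanX] :=
  span_of_pred (fun x => exists2 g, g \in unitmx & x = glact V g v).
have sU : glstable <<X>>%VS.
  move=> g gU; rewrite limg_span; apply/span_subvP => _ /mapP [x /PX [h hU ->] ->].
  by apply: spanX; exists (g *m h); rewrite ?unitmx_mul ?gU ?glact_mul.
have vU : v \in <<X>>%VS.
  by apply: spanX; exists 1%:M; rewrite ?unitmx1 // glact1 id_lfunE.
exists <<X>>%VS, sU, vU => U' sU' vU'.
apply/eqP; rewrite eqEsubv subvf /=; apply/subvP => x _.
have : vsval x \in <<X>>%VS by apply: subvsP.
rewrite -[x in x \in U']vsvalK.
apply: (span_ind (P := fun y => vsproj <<X>>%VS y \in U')) => [|c y z yU zU|y].
- by rewrite linear0 mem0v.
- by rewrite linearP memvD // memvZ.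
move=> /PX [g gU ->]; have /subvP := sU' g gU; apply.
have -> : vsproj <<X>>%VS (glact V g v) =
    glact (subrep sU) g (vsproj <<X>>%VS v).
  apply: (can_inj vsvalK); rewrite [RHS]subactE // !vsprojK //.
  by have /subvP := sU g gU; apply; apply: memv_img.
exact: memv_img.
Qed.

(* For generic z, the matrix g + z lies in the big cell. *)
Lemma cyclic_span_lower V mu (v : V) (U : {vspace V}) :
  rational_coefs V -> cyclic v -> weight_vector mu v ->
  (forall l, lower_unitriangular l -> glact V l v \in U) -> U = fullv.
Proof.
move=> Vrat vcyc vmu vU; apply: (cyclic_span_orbit vcyc) => g gU.
apply/negPn/negP => /functional_sep [f fU fg].
(* The matrix [char_poly_mx (- g)] is the line of all g + z. At generic z the factor u scales [v],
   so that f vanishes; hence the polynomial [q] is 0, and z = 0 gives back g itself. *)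
have [q [N qN]] := ratfun_path (char_poly_mx (- g)) (Vrat f v).
have evalE z : evalmx (char_poly_mx (- g)) z = g + z%:M.
  apply/matrixP => i j; rewrite !mxE /= /horner_eval hornerD hornerN hornerMn.
  by rewrite hornerX hornerC opprK addrC.
have [p pn0 pP] := LU_generic g.
have q0 : q = 0.
  apply: (horner_eq0_generic pn0) => z /pP [l [u [llow uup uU lu]]].
  have lU := lower_unitriangular_unit llow.
  rewrite -qN evalE lu ?unitmx_mul ?lU // glact_mul // vmu //.
  by rewrite !linearZ /= fU ?vU // scaler0 mul0r.
have := qN 0; rewrite evalE raddf0 addr0 q0 horner0 => /(_ gU)/eqP.
by rewrite mulf_eq0 (negbTE fg) expf_eq0 -[_ == 0]negbK -unitfE -unitmxE gU andbF.
Qed.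

(* The torus element t(z) = diag(1, z, ..., z^(d-1)) contracts the lower
   unitriangular group: t(z) l t(z)^-1 is polynomial in z and is 1 at z = 0. *)
Definition contraction (l : 'M[C]_d) : 'M[{poly C}]_d :=
  \matrix_(i, j) (l i j *: 'X^(i - j)).

Definition contracting (z : C) : 'M[C]_d := diag_mx (\row_i z ^+ i).

Lemma contraction_low l z :
  lower_unitriangular l -> lower_unitriangular (evalmx (contraction l) z).
Proof.
case/andP => /is_trig_mxP ltrig /forallP l1; apply/andP; split.
  apply/is_trig_mxP => i j ij; rewrite !mxE ltrig // /= /horner_eval.
  by rewrite hornerZ hornerXn mul0r.
apply/forallP => i; rewrite !mxE (eqP (l1 i)) subnn /= /horner_eval.
by rewrite hornerZ hornerXn expr0 mulr1.
Qed.

Lemma contraction0 l : lower_unitriangular l -> evalmx (contraction l) 0 = 1%:M.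
Proof.
case/andP => /is_trig_mxP ltrig /forallP l1; apply/matrixP => i j.
rewrite !mxE /= /horner_eval hornerZ hornerXn expr0n subn_eq0.
case: (ltngtP i j) => [ij|ij|/val_inj ->].
- by rewrite ltrig // mul0r -(inj_eq val_inj) ltn_eqF.
- by rewrite mulr0 -(inj_eq val_inj) gtn_eqF.
- by rewrite mulr1 (eqP (l1 j)) eqxx.
Qed.

Lemma contractionE l z : lower_unitriangular l ->
  contracting z *m l = evalmx (contraction l) z *m contracting z.
Proof.
case/andP => /is_trig_mxP ltrig _; apply/matrixP => i j.
rewrite mul_diag_mx mul_mx_diag !mxE /= /horner_eval hornerZ hornerXn.
case: (ltnP i j) => ij; first by rewrite ltrig // mulr0 !mul0r.
by rewrite -mulrA -exprD subnK // mulrC.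
Qed.

Lemma contracting_unit z : z != 0 -> contracting z \in unitmx.
Proof.
move=> z0; rewrite unitmxE det_diag unitfE.
by apply/prodf_neq0 => i _; rewrite !mxE expf_neq0.
Qed.

Lemma contracting_upper z : upper_triangular (contracting z).
Proof. by move=> i j ij; rewrite !mxE -(inj_eq val_inj) gtn_eqF. Qed.

(** Apply t(z), divide by the character and let z tend to 0. On the lower unitriangular orbit of [v]
    the limit is [v], so on its span, which is everything, the limit is a multiple c of [v]. A
    vector of weight [mu] is its own limit. The predicate [Q] states this with one c for all
    functionals f. *)
Lemma weight_vector_unique V mu (v v' : V) :
  rational_coefs V -> cyclic v -> weight_vector mu v -> weight_vector mu v' ->
  exists c, v' = c *: v.
Proof.
move=> Vrat vcyc vmu v'mu.
pose chi z := \prod_(i < d) (contracting z) i i ^ mu i.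
have chi0 z : z != 0 -> chi z != 0.
  move=> z0; apply/prodf_neq0 => i _; rewrite expfz_neq0 // !mxE eqxx mulr1n.
  by rewrite expf_neq0.
pose Q x := exists c, forall f : 'Hom(V, C^o), exists2 q : {poly C},
  q.[0] = c * f v & forall z, z != 0 ->
    f (glact V (contracting z) x) = chi z * q.[z].
have [X PX spanX] :=
  span_of_pred (fun x => exists2 l, lower_unitriangular l & x = glact V l v).
have : v' \in <<X>>%VS.
  rewrite (cyclic_span_lower (U := <<X>>%VS) Vrat vcyc vmu) ?memvf // => l llow.
  by apply: spanX; exists l.
move=> /(span_ind (P := Q)) [|a x y [c xc] [c' yc']|_ /PX [l llow ->]|c cP].
- exists 0 => f; exists 0 => [|z _]; first by rewrite horner0 mul0r.
  by rewrite !linear0 horner0 mulr0.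
- exists (a * c + c') => f; have [q q0 qP] := xc f; have [r r0 rP] := yc' f.
  exists (a *: q + r) => [|z z0]; rewrite !hornerE ?q0 ?r0 ?mulrDl ?mulrA //.
  rewrite !linearP /= qP // rP // mulrDr; congr (_ + _); exact: mulrCA.
(* Here t(z) l v = (t(z) l t(z)^-1) t(z) v, and the bracket is a polynomial curve of determinant 1,
   so no denominator remains. *)
- exists 1 => f; have [q [N qN]] := ratfun_path (contraction l) (Vrat f v).
  have {}qN z : f (glact V (evalmx (contraction l) z) v) = q.[z].
    have lz := contraction_low z llow.
    rewrite -qN ?lower_unitriangular_unit // det_lower_unitriangular //.
    by rewrite expr1n mulr1.
  exists q => [|z z0].
    by rewrite -qN contraction0 // glact1 id_lfunE mul1r.
  have tU := contracting_unit z0; have lU := lower_unitriangular_unit llow.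
  have lzU := lower_unitriangular_unit (contraction_low z llow).
  rewrite -glact_mul // contractionE // glact_mul //.
  rewrite vmu //; last exact: contracting_upper.
  by rewrite !linearZ /= qN.
(* For [v'] the polynomial [q] equals the constant f v' at every z other than 0, hence also at 0,
   where its value is c f v. *)
exists c; apply: functional_eq => f; have [q q0 qP] := cP f.
have qE : q - (f v')%:P = 0.
  apply: (@horner_eq0_generic _ 'X); first by rewrite polyX_eq0.
  move=> z; rewrite hornerX => z0.
  apply: (mulfI (chi0 z z0)); rewrite mulr0 !hornerE mulrBr -qP //.
  rewrite v'mu ?contracting_unit //; last exact: contracting_upper.
  by rewrite linearZ /= subrr.
by rewrite linearZ /= -[LHS](hornerC _ 0) -(subr0_eq qE).
Qed.

End Cyclic.

(** * Contravariant Hermitian forms *)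

Section Contravariant.
Variables (C : numClosedFieldType) (d : nat).
Implicit Types V W : glrep C d.

Definition adjmx (g : 'M[C]_d) : 'M[C]_d := map_mx Num.conj g^T.

Lemma adjmxK : involutive adjmx.
Proof. by move=> g; apply/matrixP => i j; rewrite !mxE conjCK. Qed.

Lemma adjmx_unit g : (adjmx g \in unitmx) = (g \in unitmx).
Proof. by rewrite map_unitmx unitmx_tr. Qed.

(* A Hermitian inner product for which the unitary group acts unitarily. *)
Definition contravariant_form V (h : V -> V -> C) : Prop :=
  [/\ forall c x y z, h (c *: x + y) z = c * h x z + h y z,
      forall x y, h y x = (h x y)^*,
      forall x, h x x = 0 -> x = 0
    & forall g, g \in unitmx ->
        forall x y, h (glact V g x) y = h x (glact V (adjmx g) y)].

Lemma contravariant_form_subrep W (U : {vspace W}) (sU : glstable U) h :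
  contravariant_form h ->
  contravariant_form (fun x y : subrep sU => h (vsval x) (vsval y)).
Proof.
case=> hlin hherm hdef hadj; split=> [c x y z|x y|x /hdef x0|g gU x y].
- by rewrite -hlin linearP.
- exact: hherm.
- by apply: (can_inj vsvalK); rewrite x0 linear0.
- by rewrite !subactE ?adjmx_unit // hadj.
Qed.

Section Projection.
Variables (V : glrep C d) (h : V -> V -> C).
Hypothesis hV : contravariant_form h.

Lemma formBl x y z : h (x - y) z = h x z - h y z.
Proof. by case: hV => hlin _ _ _; rewrite addrC -scaleN1r hlin mulN1r addrC. Qed.

Lemma form0l z : h 0 z = 0.
Proof. by rewrite -(subrr 0) formBl subrr. Qed.

Lemma formZl c x z : h (c *: x) z = c * h x z.
Proof. by case: hV => hlin _ _ _; rewrite -[_ *: _]addr0 hlin form0l addr0. Qed.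

Lemma form_suml I (r : seq I) (c : I -> C) (F : I -> V) y :
  h (\sum_(i <- r) c i *: F i) y = \sum_(i <- r) c i * h (F i) y.
Proof.
case: hV => hlin _ _ _; elim: r => [|i r IHr].
  by rewrite !big_nil form0l.
by rewrite !big_cons hlin IHr.
Qed.

Lemma form_orth_basis (U : {vspace V}) x :
  (forall i : 'I_(\dim U), h x (vbasis U)`_i = 0) ->
  {in U, forall u, h x u = 0}.
Proof.
case: hV => _ hherm _ _ x0 u /coord_vbasis ->.
rewrite hherm form_suml big1 ?rmorph0 // => i _.
by rewrite hherm x0 rmorph0 mulr0.
Qed.

(** The coordinates of w' solve a linear system given by the Gram matrix of a basis of [U]. A kernel
    vector of that matrix yields an element of [U] orthogonal to [U], hence to itself, so it is 0 by
    definiteness. *)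
Lemma form_projection (U : {vspace V}) w :
  exists2 w', w' \in U & {in U, forall u, h (w - w') u = 0}.
Proof.
case: (hV) => hlin hherm hdef _.
pose e i := (vbasis U)`_i; pose G := \matrix_(i < \dim U, j < \dim U) h (e i) (e j).
have Gunit : G \in unitmx.
  rewrite -row_free_unit -kermx_eq0; apply/eqP/row_matrixP => r.
  rewrite row0; have : (row r (kermx G) <= kermx G)%MS by apply: row_sub.
  move: (row r _) => c /sub_kermxP cG.
  have x0 : \sum_i c 0 i *: e i = 0.
    apply/hdef/(@form_orth_basis U); last first.
      by apply: memv_suml => i _; apply/memvZ/vbasis_mem/mem_nth; rewrite size_tuple.
    move=> j; rewrite form_suml; have /rowP/(_ j) := cG.
    by rewrite !mxE => {2}<-; apply: eq_bigr => i _; rewrite mxE.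
  have /freeP free := basis_free (vbasisP U).
  by apply/rowP => i; rewrite mxE; apply: (free (fun i => c 0 i)).
pose b := \row_(j < \dim U) h w (e j); pose c := b *m invmx G.
exists (\sum_i c 0 i *: e i).
  by apply: memv_suml => i _; apply/memvZ/vbasis_mem/mem_nth; rewrite size_tuple.
apply: form_orth_basis => j.
rewrite formBl form_suml.
have /rowP/(_ j) : c *m G = b by rewrite mulmxKV.
rewrite !mxE => <-; apply/eqP; rewrite subr_eq0; apply/eqP.
by apply: eq_bigr => i _; rewrite !mxE.
Qed.

(* The orthogonal projection of w to a submodule again has weight mu, hence is
   a multiple of w. *)
Lemma contravariant_irreducible mu (w : V) : rational_coefs V ->
  cyclic w -> highest_weight_vector mu w -> gl_irreducible V.
Proof.
move=> Vrat wcyc [w0 wmu]; case: (hV) => hlin hherm hdef hadj.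
split=> [V0|U sU].
  by apply: w0; apply/eqP; rewrite -memv0 -V0 memvf.
have stab g u : g \in unitmx -> u \in U -> glact V g u \in U.
  by move=> gU uU; have /subvP := sU g gU; apply; apply: memv_img.
have [w' w'U orth] := form_projection U w.
have w'mu : weight_vector mu w'.
  move=> b bU bup; apply/eqP; rewrite -subr_eq0; apply/eqP/hdef.
  set c := \prod_(i < d) _; set x := _ - _.
  (* The vector [x] lies in [U]. It is also orthogonal to [U]: it is a combination of w - w' and its
     image under b, and moving b across the form keeps the other argument in [U]. *)
  have xU : x \in U by rewrite rpredB ?stab // memvZ.
  have xE : x = - (glact V b (w - w') - c *: (w - w')).
    by rewrite opprB scalerBr [glact V b _]linearB /= wmu // -/c opprB addrC addrA subrK.
  rewrite {1}xE -scaleN1r formZl formBl hadj // formZl !orth ?stab ?adjmx_unit //.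
  by rewrite mulr0 subrr mulr0.
have [c w'E] := weight_vector_unique Vrat wcyc wmu w'mu.
have [c0|cn0] := eqVneq c 0; last first.
  right; apply: wcyc => //.
  have -> : w = c^-1 *: w' by rewrite w'E scalerA mulVf // scale1r.
  exact: memvZ.
(* Now w' = 0, so [w] is orthogonal to [U]. By contravariance so is its whole orbit, which spans the
   module; hence [u] is orthogonal to everything. *)
left; apply/eqP; rewrite -subv0; apply/subvP => u uU; rewrite memv0.
have orthU g : g \in unitmx -> h u (glact V g w) = 0.
  move=> gU; rewrite -[g]adjmxK -hadj ?adjmx_unit // hherm.
  have := orth _ (stab _ _ (etrans (adjmx_unit g) gU) uU).
  by rewrite w'E c0 scale0r subr0 => ->; rewrite rmorph0.
apply/eqP/hdef; apply: (@form_orth_basis fullv); last exact: memvf.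
move=> i; apply/eqP; rewrite hherm conjC_eq0; apply/eqP.
have [X PX spanX] :=
  span_of_pred (fun x => exists2 g, g \in unitmx & x = glact V g w).
have : (vbasis {:V})`_i \in <<X>>%VS.
  by rewrite (cyclic_span_orbit (U := <<X>>%VS) wcyc) ?memvf // => g gU;
     apply: spanX; exists g.
apply: (span_ind (P := fun x => h x u = 0)) => [|a x y xu yu|_ /PX [g gU ->]].
- by rewrite form0l.
- by rewrite hlin xu yu mulr0 addr0.
- by rewrite hherm orthU // rmorph0.
Qed.

End Projection.

End Contravariant.

(** * Uniqueness of irreducible modules of a given highest weight *)

Section Isomorphism.
Variables (C : numFieldType) (d : nat).
Implicit Types V W : glrep C d.

Section DirectSum.
Variables V W : glrep C d.

Definition dsum_fun g (x : V * W) : V * W := (glact V g x.1, glact W g x.2).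

Lemma dsum_fun_linear g : linear (dsum_fun g).
Proof. by move=> c x y; rewrite /dsum_fun !linearP. Qed.

HB.instance Definition _ g :=
  GRing.isLinear.Build C (V * W)%type (V * W)%type _ (dsum_fun g)
    (dsum_fun_linear g).

Definition dsum_act g : 'End((V * W)%type) := linfun (dsum_fun g).

Lemma dsum_act1 : dsum_act 1%:M = \1%VF.
Proof.
apply/lfunP => x; rewrite lfunE id_lfunE /= /dsum_fun !glact1 !id_lfunE.
by case: x.
Qed.

Lemma dsum_actM : {in unitmx &, forall g h,
  dsum_act (g *m h) = (dsum_act g \o dsum_act h)%VF}.
Proof.
move=> g h gU hU; apply/lfunP => x.
by rewrite comp_lfunE !lfunE /= /dsum_fun !glact_mul.
Qed.

Definition dsum : glrep C d := GLRep dsum_act1 dsum_actM.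

Definition dsum_inl (x : V) : dsum := (x, 0).
Definition dsum_inr (y : W) : dsum := (0, y).

Lemma dsum_inl_linear : linear dsum_inl.
Proof. by move=> c x y; rewrite -[RHS]/(c *: x + y, c *: 0 + 0) scaler0 addr0. Qed.

Lemma dsum_inr_linear : linear dsum_inr.
Proof. by move=> c x y; rewrite -[RHS]/(c *: 0 + 0, c *: x + y) scaler0 addr0. Qed.

HB.instance Definition _ :=
  GRing.isLinear.Build C V dsum _ dsum_inl dsum_inl_linear.
HB.instance Definition _ :=
  GRing.isLinear.Build C W dsum _ dsum_inr dsum_inr_linear.

Lemma dsum_rational :
  rational_coefs V -> rational_coefs W -> rational_coefs dsum.
Proof.
move=> Vrat Wrat f x.
pose f1 := (f \o linfun dsum_inl)%VF.
pose f2 := (f \o linfun dsum_inr)%VF.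
apply: eq_ratfun (ratfunD (Vrat f1 x.1) (Wrat f2 x.2)) => g.
have -> : glact dsum g x = dsum_inl (glact V g x.1) + dsum_inr (glact W g x.2).
  rewrite -[RHS]/(glact V g x.1 + 0, 0 + glact W g x.2) addr0 add0r.
  by rewrite lfunE.
by rewrite linearD !comp_lfunE !lfunE.
Qed.

End DirectSum.

Lemma subrep_rational W (U : {vspace W}) (sU : glstable U) :
  rational_coefs W -> rational_coefs (subrep sU).
Proof.
move=> Wrat f x.
suff: ratfun (fun g => (f \o linfun (vsproj U))%VF (glact W g (vsval x))).
  have e g : g \in unitmx ->
    (f \o linfun (vsproj U))%VF (glact W g (vsval x)) =
    f (glact (subrep sU) g x).
    by move=> gU; rewrite comp_lfunE lfunE /= -subactE // vsvalK.
  by case=> p [N pN]; exists p, N => g gU; rewrite -pN // e.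
exact: Wrat.
Qed.

Definition equivariant V W (f : 'Hom(V, W)) : Prop :=
  forall g, g \in unitmx -> forall x, f (glact V g x) = glact W g (f x).

Lemma lker_stable V W (f : 'Hom(V, W)) : equivariant f -> glstable (lker f).
Proof.
move=> fg g gU; apply/subvP => _ /memv_imgP [x xK ->].
by rewrite memv_ker fg //; move: xK; rewrite memv_ker => /eqP ->; rewrite linear0.
Qed.

Lemma limg_stable V W (f : 'Hom(V, W)) (U : {vspace V}) :
  equivariant f -> glstable U -> glstable (f @: U)%VS.
Proof.
move=> fg sU g gU; apply/subvP => _ /memv_imgP [_ /memv_imgP [x xU ->] ->].
rewrite -fg // memv_img //; have /subvP := sU g gU; apply; exact: memv_img.
Qed.

Lemma irreducible_ker0 V W (f : 'Hom(V, W)) x : gl_irreducible V ->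
  equivariant f -> f x != 0 -> lker f == 0%VS.
Proof.
move=> [_ Virr] /lker_stable /Virr [->|kV]; rewrite ?eqxx // => fx.
by case/negP: fx; rewrite -memv_ker kV memvf.
Qed.

Lemma irreducible_limg V W (f : 'Hom(V, W)) x : gl_irreducible W ->
  equivariant f -> f x != 0 -> limg f = fullv.
Proof.
move=> [_ Wirr] fg fx.
have : glstable (limg f) by apply: limg_stable => // g _; apply: subvf.
case/Wirr => // f0; case/negP: fx.
by rewrite -memv0 -f0 memv_img ?memvf.
Qed.

Lemma bij_lker0_limg V W (f : 'Hom(V, W)) :
  lker f == 0%VS -> limg f = fullv -> bijective f.
Proof.
move=> kf imf; exists f^-1%VF; first exact: lker0_lfunK.
by move=> y; rewrite limg_lfunVK // imf memvf.
Qed.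

(* The submodule of V + W generated by (v, w) is the graph of an isomorphism:
   otherwise it contains (0, w), and (0, w) is not a multiple of (v, w). *)
Lemma irreducible_iso V W mu (v : V) (w : W) :
  rational_coefs V -> gl_irreducible V -> highest_weight_vector mu v ->
  rational_coefs W -> gl_irreducible W -> highest_weight_vector mu w ->
  gl_isomorphic V W.
Proof.
move=> Vrat Virr [v0 vmu] Wrat Wirr [w0 wmu].
have [M [sM [vwM Mcyc]]] := @orbit_span C d (dsum V W) (v, w).
set m := vsproj M _ in Mcyc.
have mE : vsval m = (v, w) by rewrite vsprojK.
have Mrat := subrep_rational (sU := sM) (dsum_rational Vrat Wrat).
have mmu : weight_vector mu (m : subrep sM).
  move=> b bU bup; apply: (can_inj vsvalK).
  by rewrite subactE // linearZ /= mE lfunE /= /dsum_fun /= vmu // wmu.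
pose p1 : 'Hom(subrep sM, V) := linfun (fst \o (vsval : subrep sM -> dsum V W)).
pose p2 : 'Hom(subrep sM, W) := linfun (snd \o (vsval : subrep sM -> dsum V W)).
have p1E x : p1 x = (vsval x).1 by rewrite lfunE.
have p2E x : p2 x = (vsval x).2 by rewrite lfunE.
have p1g : equivariant p1.
  by move=> g gU x; rewrite !p1E subactE // lfunE.
have p2g : equivariant p2.
  by move=> g gU x; rewrite !p2E subactE // lfunE.
have im1 : limg p1 = fullv.
  by apply: (@irreducible_limg _ _ p1 m); rewrite // p1E mE; apply/eqP.
have ker1 : lker p1 == 0%VS.
  (* The elements (0, y) of [M] give a submodule of [W]. If it is 0, then [p1] is injective; if it
     is [W], then (0, w) is a second vector of weight [mu] in the cyclic module [M]. *)
  have s2 := limg_stable p2g (lker_stable p1g).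
  case: (Wirr) => _ /(_ _ s2) [K0|KW].
    rewrite -subv0; apply/subvP => x xK; rewrite memv0.
    have : p2 x \in (p2 @: lker p1)%VS by apply: memv_img.
    rewrite K0 memv0 p2E; move: xK; rewrite memv_ker p1E => x1 x2.
    apply/eqP/(can_inj vsvalK); rewrite linear0.
    by apply/pair_eqP; rewrite /= x1 x2.
  have : w \in (p2 @: lker p1)%VS by rewrite KW memvf.
  case/memv_imgP => x; rewrite memv_ker p1E p2E => /eqP x1 wE.
  have xE : vsval x = (0, w) by rewrite wE -x1; case: (vsval x).
  have xmu : weight_vector mu (x : subrep sM).
    move=> b bU bup; apply: (can_inj vsvalK).
    rewrite subactE // linearZ /= xE lfunE /= /dsum_fun /= linear0 wmu //.
    by apply/pair_eqP; rewrite /= scaler0 !eqxx.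
  have [c /(congr1 vsval)] := weight_vector_unique Mrat Mcyc mmu xmu.
  rewrite linearZ /= xE mE => -[/esym/eqP].
  rewrite scaler_eq0 => /orP [/eqP -> |/eqP /v0 //].
  by rewrite scale0r => /w0.
have p1K := lker0_lfunK ker1.
have p1VK x : p1 (p1^-1%VF x) = x by rewrite limg_lfunVK // im1 memvf.
have fg : equivariant (p2 \o p1^-1)%VF.
  move=> g gU x; rewrite !comp_lfunE -p2g //; congr (p2 _).
  by rewrite -{1}[x]p1VK -p1g // p1K.
have fv : (p2 \o p1^-1)%VF v != 0.
  have -> : v = p1 m by rewrite p1E mE.
  by rewrite comp_lfunE p1K p2E mE; apply/eqP.
exists (p2 \o p1^-1)%VF; split=> [|g gU]; last first.
  by apply/lfunP => x; rewrite comp_lfunE fg // [RHS]comp_lfunE.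
apply: bij_lker0_limg; last exact: irreducible_limg fv.
exact: irreducible_ker0 fv.
Qed.

End Isomorphism.

(** The submodule generated by [w] inherits rational coefficients and the form, so
    [contravariant_irreducible] applies to it. *)
Lemma highest_weight_submodule (C : numClosedFieldType) d (W : glrep C d)
    (h : W -> W -> C) mu (w : W) :
  rational_coefs W -> contravariant_form h -> highest_weight_vector mu w ->
  exists (U : {vspace W}) (sU : glstable U),
    irreducible_of_highest_weight mu (subrep sU).
Proof.
move=> Wrat hW [w0 wmu]; have [U [sU [wU Ucyc]]] := orbit_span w.
have Urat : rational_coefs (subrep sU) := subrep_rational Wrat.
have umu : highest_weight_vector mu (vsproj U w : subrep sU).
  split=> [/(congr1 vsval)|b bU bup]; first by rewrite vsprojK // linear0.
  apply: (can_inj vsvalK).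
  by rewrite subactE // linearZ /= vsprojK // wmu.
exists U, sU; split; [exact/rational_coefsP| |by exists (vsproj U w)].
have hU := contravariant_form_subrep sU hW.
exact: (contravariant_irreducible hU Urat Ucyc umu).
Qed.

(** * Frames of symmetric powers *)

Section PureTensors.
Variables (C : numFieldType) (V : vectType C) (m : nat).
Local Notation e := (vbasis {:V}).
Local Notation word := {ffun 'I_m -> 'I_(\dim {:V})}.

(** The pure tensor of the vectors x a, in coordinates. *)
Definition ptensor (x : 'I_m -> V) : tensors V m :=
  [ffun I : word => \prod_(a < m) coord e (I a) (x a)].

Lemma eq_ptensor x y : x =1 y -> ptensor x = ptensor y.
Proof. by move=> xy; apply/ffunP => I; rewrite !ffunE; under eq_bigr do rewrite xy. Qed.

Lemma ptensor_sum (X : finType) (c : 'I_m -> X -> C) (u : X -> V) :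
  ptensor (fun a => \sum_x c a x *: u x) =
  \sum_(K : {ffun 'I_m -> X}) (\prod_a c a (K a)) *: ptensor (u \o K).
Proof.
apply/ffunP => I; rewrite ffunE sum_ffunE.
under eq_bigr => a _ do rewrite linear_sum.
rewrite bigA_distr_bigA; apply: eq_bigr => K _; rewrite !ffunE.
rewrite -[RHS]/(_ * _) -big_split; apply: eq_bigr => a _.
by rewrite linearZ.
Qed.

Lemma ptensor_span (T : tensors V m) :
  T = \sum_(I : word) T I *: ptensor (fun a => e`_(I a)).
Proof.
apply/ffunP => J; rewrite sum_ffunE (bigD1 J) //= big1 => [|I neqIJ]; rewrite !ffunE.
  rewrite big1 => [|a _]; last by rewrite coord_free ?eqxx // (basis_free (vbasisP _)).
  by rewrite addr0 -[RHS]/(_ * _) mulr1.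
have [a neqa] : exists a, I a != J a.
  apply/existsP; apply: contraR neqIJ => /existsPn eqIJ.
  by apply/eqP/ffunP => a; apply/eqP; have := eqIJ a; rewrite negbK.
rewrite (bigD1 a) //= coord_free ?(basis_free (vbasisP _)) //.
by rewrite (negbTE neqa) mul0r scaler0.
Qed.

Lemma tensor_hom_ext (W : vectType C) (f g : 'Hom(tensors V m, W)) :
  (forall x, f (ptensor x) = g (ptensor x)) -> f = g.
Proof.
move=> fg; apply/lfunP => T; rewrite (ptensor_span T) !linear_sum.
by apply: eq_bigr => I _; rewrite !linearZ /= fg.
Qed.

Lemma tensor_fun_ptensor (f : 'End(V)) x :
  tensor_fun f (ptensor x) = ptensor (f \o x).
Proof.
rewrite (@eq_ptensor (f \o x) (fun a => \sum_i coord e i (x a) *: f e`_i)).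
  rewrite ptensor_sum; apply/ffunP => J; rewrite ffunE sum_ffunE.
  by apply: eq_bigr => I _; rewrite !ffunE mulrC.
move=> a /=; rewrite {1}(coord_vbasis (memvf (x a))) linear_sum.
by apply: eq_bigr => i _; rewrite linearZ.
Qed.

(** The tensor product of the functionals f a. *)
Definition tensor_eval_fun (f : 'I_m -> 'Hom(V, C^o)) (T : tensors V m) : C^o :=
  \sum_(I : word) T I *: \prod_a f a e`_(I a).

Lemma tensor_eval_linear f : linear (tensor_eval_fun f).
Proof.
move=> c S T; rewrite scaler_sumr -big_split; apply: eq_bigr => I _.
by rewrite !ffunE scalerDl scalerA.
Qed.

HB.instance Definition _ f :=
  GRing.isLinear.Build C (tensors V m) C^o _ (tensor_eval_fun f)
    (tensor_eval_linear f).

Definition tensor_eval f : 'Hom(tensors V m, C^o) := linfun (tensor_eval_fun f).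

Lemma tensor_eval_ptensor f x : tensor_eval f (ptensor x) = \prod_a f a (x a).
Proof.
rewrite lfunE /= /tensor_eval_fun.
under [RHS]eq_bigr => a _.
  rewrite (coord_vbasis (memvf (x a))) linear_sum; over.
rewrite [RHS]bigA_distr_bigA; apply: eq_bigr => I _; rewrite ffunE.
rewrite -[LHS]/(_ * _) -big_split; apply: eq_bigr => a _.
by rewrite linearZ.
Qed.

Lemma perm_fun_ptensor (s : 'S_m) x :
  perm_fun s (ptensor x) = ptensor (fun a => x ((s^-1)%g a)).
Proof.
apply/ffunP => I; rewrite !ffunE (reindex_inj (@perm_inj _ s^-1%g)) /=.
by apply: eq_bigr => a _; rewrite ffunE permKV.
Qed.

Definition symmetrize (T : tensors V m) : tensors V m :=
  (m`!%:R : C)^-1 *: \sum_(s : 'S_m) perm_fun s T.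

Lemma symmetrize_linear : linear symmetrize.
Proof.
move=> c S T; rewrite /symmetrize scalerA mulrC -scalerA -scalerDr; congr (_ *: _).
rewrite scaler_sumr -big_split; apply: eq_bigr => s _.
by rewrite linearP.
Qed.

HB.instance Definition _ :=
  GRing.isLinear.Build C (tensors V m) (tensors V m) _ symmetrize
    symmetrize_linear.

Lemma symmetrize_sym T : symmetrize T \in symmetric_tensors.
Proof.
apply/symmetric_tensorsP => t; rewrite /symmetrize linearZ linear_sum; congr (_ *: _).
rewrite [RHS](reindex_inj (mulIg t)); apply: eq_bigr => s _.
apply/ffunP => J; rewrite !ffunE; congr (T _).
by apply/ffunP => a; rewrite !ffunE permM.
Qed.

Lemma symmetrize_avg (W : vectType C) (f : 'Hom(tensors V m, W)) T :
  (forall s, f (perm_fun s T) = f T) -> f (symmetrize T) = f T.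
Proof.
move=> fT; rewrite /symmetrize linearZ linear_sum /=.
under eq_bigr do rewrite fT.
rewrite sumr_const card_Sn -scaler_nat scalerA mulVf ?scale1r //.
by rewrite pnatr_eq0 -lt0n fact_gt0.
Qed.

Lemma symmetrize_id T : T \in symmetric_tensors -> symmetrize T = T.
Proof.
move=> /symmetric_tensorsP Tsym.
by have := @symmetrize_avg _ \1%VF T; rewrite !id_lfunE; apply=> s; rewrite !id_lfunE.
Qed.

Lemma tensor_fun_symmetrize f T :
  tensor_fun f (symmetrize T) = symmetrize (tensor_fun f T).
Proof.
rewrite /symmetrize linearZ linear_sum; congr (_ *: _).
by apply: eq_bigr => s _; rewrite /= tensor_map_perm.
Qed.

Lemma tensor_eval_symmetrize (f : 'Hom(V, C^o)) T :
  tensor_eval (fun=> f) (symmetrize T) = tensor_eval (fun=> f) T.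
Proof.
apply: symmetrize_avg => s; have sE T' : perm_fun s T' = Defs.perm_map s T' by rewrite lfunE.
rewrite sE -comp_lfunE; congr (fun_of_lfun _ T); apply: tensor_hom_ext => x.
rewrite comp_lfunE -sE perm_fun_ptensor !tensor_eval_ptensor.
by rewrite [RHS](reindex_inj (@perm_inj _ s^-1%g)).
Qed.

End PureTensors.

(* A frame is a finite family of vectors with a chosen dual family of
   functionals; it presents V as an equivariant retract of the matrix
   representation A. *)
Record frame (C : fieldType) (d : nat) (V : glrep C d) (X : finType)
    (A : 'M[C]_d -> X -> X -> C) := Frame {
  frame_vec : X -> V;
  frame_coord : X -> 'Hom(V, C^o);
  frameE : forall v, \sum_x frame_coord x v *: frame_vec x = v;
  frame_vec_act : forall g, g \in unitmx -> forall y,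
    glact V g (frame_vec y) = \sum_x A g x y *: frame_vec x;
  frame_coord_act : forall g, g \in unitmx -> forall x v,
    frame_coord x (glact V g v) = \sum_y A g x y *: frame_coord y v }.

Section Frames.
Variables (C : numFieldType) (d : nat).

Lemma frame_rational (V : glrep C d) X A (F : @frame C d V X A) :
  (forall x y, ratfun (fun g => A g x y)) -> rational_coefs V.
Proof.
move=> Arat f v.
have [p [N pN]] : ratfun (fun g => \sum_x \sum_y
    (frame_coord F y v * f (frame_vec F x)) * A g x y).
  by do 2!apply: ratfun_sum => ?; apply: ratfunM => //; apply: ratfun_cst.
exists p, N => g gU; rewrite -pN // -{1}(frameE F v) !linear_sum exchange_big /=.
apply: eq_bigr => y _; rewrite !linearZ /= frame_vec_act // linear_sum scaler_sumr.
by apply: eq_bigr => x _; rewrite linearZ /= -mulrA [f _ * _]mulrC.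
Qed.

Lemma frame_comb_act (V : glrep C d) X A (F : @frame C d V X A) (c : X -> C) g :
  g \in unitmx -> glact V g (\sum_y c y *: frame_vec F y) =
  \sum_x (\sum_y c y * A g x y) *: frame_vec F x.
Proof.
move=> gU; rewrite linear_sum.
under eq_bigr => y _ do rewrite linearZ /= frame_vec_act // scaler_sumr.
rewrite exchange_big; apply: eq_bigr => x _ /=.
by rewrite scaler_suml; apply: eq_bigr => y _; rewrite scalerA.
Qed.

Definition std_coord_fun (i : 'I_d) (v : 'cV[C]_d) : C^o := v i 0.

Lemma std_coord_linear i : linear (std_coord_fun i).
Proof. by move=> c u v; rewrite /std_coord_fun !mxE. Qed.

HB.instance Definition _ i :=
  GRing.isLinear.Build C 'cV[C]_d C^o _ (std_coord_fun i) (std_coord_linear i).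

Definition std_coord i : 'Hom(std_rep C d, C^o) := linfun (std_coord_fun i).

Definition std_vec (i : 'I_d) : std_rep C d := delta_mx i 0 : 'cV[C]_d.

Lemma std_frameE (v : std_rep C d) : \sum_i std_coord i v *: std_vec i = v.
Proof.
rewrite [RHS](@matrix_sum_delta _ d 1); apply: eq_bigr => i _.
by rewrite big_ord1 lfunE.
Qed.

Lemma std_vec_act g : g \in unitmx -> forall j,
  glact (std_rep C d) g (std_vec j) = \sum_i g i j *: std_vec i.
Proof.
move=> _ j; rewrite lfunE /=; apply/matrixP => i k.
rewrite summxE mxE [LHS](bigD1 j) //= [RHS](bigD1 i) //= !mxE !eqxx !ord1 eqxx.
rewrite [X in _ + X = _]big1 => [|l lj]; last by rewrite !mxE (negbTE lj) mulr0.
by rewrite big1 // => l li; rewrite !mxE eq_sym (negbTE li) mulr0.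
Qed.

Lemma std_coord_act g : g \in unitmx -> forall i v,
  std_coord i (glact (std_rep C d) g v) = \sum_j g i j *: std_coord j v.
Proof.
move=> _ i v; rewrite lfunE /= lfunE /= /std_coord_fun mxE.
by apply: eq_bigr => j _; rewrite lfunE.
Qed.

Definition std_frame : frame (std_rep C d) (fun g i j => g i j) :=
  Frame std_frameE std_vec_act std_coord_act.

Section SymFrame.
Variables (V : glrep C d) (X : finType) (A : 'M[C]_d -> X -> X -> C).
Variables (F : frame V A) (m : nat).
Local Notation SV := (sym_power m V).
Local Notation word := {ffun 'I_m -> X}.

Definition sym_proj (T : tensors V m) : SV :=
  vsproj (@symmetric_tensors C V m) (symmetrize T).

Lemma sym_projE T : vsval (sym_proj T) = symmetrize T.
Proof. by rewrite vsprojK // symmetrize_sym. Qed.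

Lemma sym_proj_linear : linear sym_proj.
Proof. by move=> c S T; rewrite /sym_proj !linearP. Qed.

HB.instance Definition _ :=
  GRing.isLinear.Build C (tensors V m) SV _ sym_proj sym_proj_linear.

Lemma sym_actE g (T : SV) : g \in unitmx ->
  vsval (glact SV g T) = tensor_fun (glact V g) (vsval T).
Proof.
by move=> gU; rewrite (subactE (@symmetric_tensors_stable C d m V)) // lfunE.
Qed.

Lemma sym_proj_act g T : g \in unitmx ->
  glact SV g (sym_proj T) = sym_proj (tensor_fun (glact V g) T).
Proof.
move=> gU; apply: (can_inj vsvalK).
by rewrite sym_actE // !sym_projE tensor_fun_symmetrize.
Qed.

(** All words are used instead of multisets. The resulting vectors are in general linearly
    dependent, which a frame permits, and the construction can be iterated. *)
Definition sym_vec (J : word) : SV := sym_proj (ptensor (frame_vec F \o J)).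

Definition sym_coord (J : word) : 'Hom(SV, C^o) :=
  (tensor_eval (fun a => frame_coord F (J a)) \o linfun vsval)%VF.

(** An entry of the m-fold Kronecker power of the matrix of g. *)
Definition sym_coef g (J K : word) : C := \prod_a A g (J a) (K a).

Lemma sym_coordE J T :
  sym_coord J T = tensor_eval (fun a => frame_coord F (J a)) (vsval T).
Proof. by rewrite comp_lfunE [linfun vsval T]lfunE. Qed.

Lemma ptensor_frame x : ptensor x =
  \sum_(J : word) (\prod_a frame_coord F (J a) (x a)) *:
    ptensor (frame_vec F \o J) :> tensors V m.
Proof. rewrite -(ptensor_sum (fun a y => frame_coord F y (x a)) (frame_vec F)).
by apply: eq_ptensor => a; rewrite frameE. Qed.

Lemma sym_frameE T : \sum_J sym_coord J T *: sym_vec J = T.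
Proof.
apply: (can_inj vsvalK); rewrite -[RHS]symmetrize_id ?subvsP //.
rewrite [in RHS](ptensor_span (vsval T)) linear_sum.
under eq_bigr do rewrite linearZ /= sym_projE sym_coordE lfunE.
under eq_bigr do rewrite scaler_suml.
rewrite exchange_big linear_sum; apply: eq_bigr => I _.
rewrite linearZ /= [in RHS]ptensor_frame linear_sum scaler_sumr.
by apply: eq_bigr => J _; rewrite /= [symmetrize (_ *: _)]linearZ /= scalerA.
Qed.

Lemma sym_vec_act g : g \in unitmx -> forall K,
  glact SV g (sym_vec K) = \sum_J sym_coef g J K *: sym_vec J.
Proof.
move=> gU K; rewrite sym_proj_act // tensor_fun_ptensor.
rewrite (@eq_ptensor _ _ _ (glact V g \o (frame_vec F \o K))
          (fun a => \sum_x A g x (K a) *: frame_vec F x)).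
  rewrite ptensor_sum linear_sum; apply: eq_bigr => J _.
  by rewrite linearZ.
by move=> a /=; rewrite frame_vec_act.
Qed.

Lemma sym_coord_act g : g \in unitmx -> forall J T,
  sym_coord J (glact SV g T) = \sum_K sym_coef g J K *: sym_coord K T.
Proof.
move=> gU J T; rewrite sym_coordE sym_actE //.
have gE S : tensor_fun (glact V g) S = tensor_map (glact V g) S by rewrite lfunE.
pose f (K : word) := tensor_eval (fun a => frame_coord F (K a)).
rewrite gE -comp_lfunE -/(f J).
suff -> : (f J \o tensor_map (glact V g))%VF = \sum_K sym_coef g J K *: f K.
  rewrite sum_lfunE; apply: eq_bigr => K _.
  by rewrite scale_lfunE sym_coordE.
apply: tensor_hom_ext => x; rewrite comp_lfunE -gE tensor_fun_ptensor.
rewrite tensor_eval_ptensor sum_lfunE /=.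
under eq_bigr do rewrite frame_coord_act //.
rewrite bigA_distr_bigA; apply: eq_bigr => K _.
by rewrite scale_lfunE tensor_eval_ptensor -[RHS]/(_ * _) -big_split.
Qed.

Definition sym_frame : frame SV sym_coef :=
  Frame sym_frameE sym_vec_act sym_coord_act.

(** The m-th tensor power of [f] has equal factors, so it does not see the symmetrisation in
    [sym_vec]. *)
Lemma sym_functional (f : 'Hom(V, C^o)) : exists f' : 'Hom(SV, C^o),
  forall J, f' (frame_vec sym_frame J) = \prod_a f (frame_vec F (J a)).
Proof.
exists (tensor_eval (fun=> f) \o linfun vsval)%VF => J.
rewrite comp_lfunE [linfun vsval _]lfunE /= sym_projE tensor_eval_symmetrize.
by rewrite tensor_eval_ptensor.
Qed.

End SymFrame.

End Frames.

(** This is the standard Hermitian product pulled back along the frame coordinates. It is definite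
    because the coordinates determine the vector. *)
Lemma frame_contravariant (C : numClosedFieldType) d (V : glrep C d) X A
    (F : @frame C d V X A) :
  (forall g x y, A (adjmx g) y x = (A g x y)^*) ->
  contravariant_form (fun u v => \sum_x frame_coord F x u * (frame_coord F x v)^*).
Proof.
move=> Aadj; split=> [c u v z|u v|u|g gU u v].
- rewrite mulr_sumr -big_split; apply: eq_bigr => x _.
  by rewrite linearP mulrDl /= mulrA.
- by rewrite rmorph_sum; apply: eq_bigr => x _; rewrite /= rmorphM /= conjCK mulrC.
- move=> /eqP; rewrite psumr_eq0 => [|x _]; last exact: mul_conjC_ge0.
  move=> /allP u0; rewrite -[u](frameE F) big1 // => x _.
  by have := u0 x (mem_index_enum x); rewrite /= mul_conjC_eq0 => /eqP ->; rewrite scale0r.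
under eq_bigr do rewrite frame_coord_act // mulr_suml.
rewrite exchange_big; apply: eq_bigr => y _.
rewrite frame_coord_act ?adjmx_unit // rmorph_sum mulr_sumr.
apply: eq_bigr => x _; rewrite /= -[_ *: _]/(_ * _) -[X in _ = _ * X^*]/(_ * _).
by rewrite Aadj rmorphM /= conjCK mulrCA mulrA.
Qed.

(** * Determinants of tableaux *)

Section TableauDeterminant.
Variables (C : comNzRingType) (T : eqType) (d N : nat).
Variables (col : 'I_N -> T) (row : 'I_N -> 'I_d).

(* The product over the columns of a tableau of the determinants with entries
   Y p i, for p a box of the column and i one of its rows. *)
Definition tabdet (Y : 'I_N -> 'I_d -> C) : C :=
  \det (\matrix_(p, q) ((col p == col q)%:R * Y p (row q))).

Lemma eq_tabdet Y Z : (forall p i, Y p i = Z p i) -> tabdet Y = tabdet Z.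
Proof. by move=> YZ; congr (\det _); apply/matrixP => p q; rewrite !mxE YZ. Qed.

(** A determinant is linear in each row, and [theta] matches rows with tensor positions: the sum
    over J replaces the unit row at p by the row G (theta p). In each term of the Leibniz formula
    the sum over J distributes over the product. *)
Lemma tabdet_multilinear (A B : finType) (theta : 'I_N -> A * B)
    (G : A * B -> 'I_d -> C) : bijective theta ->
  \sum_(J : {ffun A -> {ffun B -> 'I_d}})
     tabdet (fun p i => (J (theta p).1 (theta p).2 == i)%:R) *
     \prod_a \prod_b G (a, b) (J a b) =
  tabdet (fun p => G (theta p)).
Proof.
move=> [theta' thetaK theta'K].
rewrite /tabdet /determinant.
under eq_bigr do rewrite mulr_suml.
rewrite exchange_big; apply: eq_bigr => s _ /=.
under eq_bigr do rewrite -mulrA.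
rewrite -mulr_sumr; congr (_ * _).
pose H (ab : A * B) (i : 'I_d) : C := let p := theta' ab in
  (col p == col (s p))%:R * (i == row (s p))%:R * G ab i.
transitivity (\sum_(J : {ffun A -> {ffun B -> 'I_d}})
    \prod_a \prod_b H (a, b) (J a b)).
  apply: eq_bigr => J _; rewrite !pair_bigA /=.
  rewrite (reindex theta) /=; last by exists theta' => ? _.
  rewrite [RHS](reindex theta) /=; last by exists theta' => ? _.
  rewrite -big_split; apply: eq_bigr => p _.
  by rewrite !mxE /H -surjective_pairing thetaK.
rewrite -(bigA_distr_bigA (fun a (f : {ffun B -> 'I_d}) => \prod_b H (a, b) (f b))).
under eq_bigr => a _.
  rewrite -(bigA_distr_bigA (fun b i => H (a, b) i)); over.
rewrite pair_bigA /= (reindex theta) /=; last by exists theta' => ? _.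
apply: eq_bigr => p _; rewrite !mxE /H -surjective_pairing thetaK.
rewrite (bigD1 (row (s p))) //= eqxx mulr1 big1 ?addr0 // => i /negbTE ->.
by rewrite mulr0 mul0r.
Qed.

Hypothesis row_inc : forall p q : 'I_N, (p < q)%N -> col p = col q -> (row p < row q)%N.
Hypothesis row_down : forall p (l : 'I_d), (l <= row p)%N ->
  exists2 r, col r = col p & row r = l.

Lemma col_row_inj p q : col p = col q -> row p = row q -> p = q.
Proof.
move=> cpq rpq; apply/val_inj; case: (ltngtP p q) => // [pq|qp].
  by have := row_inc pq cpq; rewrite rpq ltnn.
by have := row_inc qp (esym cpq); rewrite rpq ltnn.
Qed.

(** The matrix on the left is the product of the unit-row matrix with G, which restricts g to the
    rows of each column of the tableau and is triangular in the order of the boxes. This yields the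
    highest weight property. *)
Lemma tabdet_triangular (g : 'I_d -> 'I_d -> C) (j : 'I_N -> 'I_d) :
  (forall i l : 'I_d, (l < i)%N -> g i l = 0) ->
  tabdet (fun p => g (j p)) =
  tabdet (fun p i => (j p == i)%:R) * \prod_p g (row p) (row p).
Proof.
move=> gup; pose G := \matrix_(r, q) ((col r == col q)%:R * g (row r) (row q)).
have -> : \prod_p g (row p) (row p) = \det G.
  rewrite -det_tr det_trig; last first.
    apply/is_trig_mxP => p q pq; rewrite !mxE; case: eqP => [e|_].
      by rewrite gup ?mulr0 // row_inc.
    by rewrite mul0r.
  by apply: eq_bigr => p _; rewrite !mxE eqxx mul1r.
rewrite -det_mulmx; congr (\det _); apply/matrixP => p q; rewrite !mxE.
have [cpq|cpq] := eqVneq (col p) (col q); last first.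
  rewrite mul0r big1 // => r _; rewrite !mxE.
  case: eqP => [<-|_]; last by rewrite !mul0r.
  by rewrite (negbTE cpq) mul0r mulr0.
(* Columns have no gaps, so an index at most [row q] is the row of exactly one box of the column,
   and the sum has one term. A larger index gives 0 on both sides, as g is upper triangular. *)
rewrite mul1r; case: (leqP (j p) (row q)) => jq.
  have [r cr rr] := row_down jq.
  rewrite (bigD1 r) //= !mxE cr cpq rr !eqxx !mul1r big1 ?addr0 // => r' r'r.
  rewrite !mxE; case: eqP => [c|_]; last by rewrite !mul0r.
  case: eqP => [e|_]; last by rewrite mulr0 mul0r.
  by case/eqP: r'r; apply: col_row_inj; rewrite ?rr // -c cpq cr.
rewrite gup // big1 // => r _; rewrite !mxE.
case: (eqVneq (j p) (row r)) => [<-|_]; last by rewrite mulr0 mul0r.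
by rewrite gup // !mulr0.
Qed.

End TableauDeterminant.

(* Column by column, a vector of the kernel is a polynomial of degree less than
   the height of the column that vanishes at the distinct points y p. *)
Lemma tabdet_Vandermonde_neq0 (F : fieldType) (T : eqType) (d N : nat)
    (col : 'I_N -> T) (row : 'I_N -> 'I_d) (y : 'I_N -> F) :
  (forall p q : 'I_N, (p < q)%N -> col p = col q -> (row p < row q)%N) ->
  (forall p (l : 'I_d), (l <= row p)%N -> exists2 r, col r = col p & row r = l) ->
  (forall p q, col p = col q -> y p = y q -> p = q) ->
  tabdet col row (fun p i => y p ^+ i) != 0.
Proof.
move=> row_inc row_down y_inj; rewrite /tabdet -det_tr.
set M := (_^T)%R; rewrite -unitfE -unitmxE -row_free_unit -kermx_eq0.
apply/eqP/row_matrixP => r; rewrite row0.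
have : (matrix.row r (kermx M) <= kermx M)%MS by apply: row_sub.
move: (matrix.row r _) => v /sub_kermxP vM; apply/rowP => q0; rewrite [RHS]mxE.
pose P : {poly F} := \sum_(q | col q == col q0) v 0 q *: 'X^(row q).
pose h := #|[pred p | col p == col q0]|.
(* Rows 0 to [row q] all occur in the column, which has [h] boxes. *)
have row_h q : col q = col q0 -> (row q < h)%N.
  move=> cq; rewrite /h; apply: leq_trans (leq_image_card row _).
  rewrite -[X in (X < _)%N]/(val (row q)) -(card_ord (row q).+1).
  rewrite -(card_image (f := widen_ord (ltn_ord (row q)))); last first.
    by move=> i j /(congr1 val) /= /val_inj.
  apply/subset_leq_card/subsetP => _ /imageP [i _ ->].
  have [|p cp <-] := row_down q (widen_ord (ltn_ord (row q)) i); first by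
    rewrite -ltnS /= ltn_ord.
  by apply: image_f; rewrite inE cp cq.
have P0 : P = 0.
  apply/eqP; apply: contraT => Pn0.
  have sP : (size P <= h)%N.
    apply: leq_trans (size_sum _ _ _) _; apply/bigmax_leqP => q /eqP cq.
    by apply: leq_trans (size_scale_leq _ _) _; rewrite size_polyXn row_h.
  have := @max_poly_roots F P [seq y p | p in [pred p | col p == col q0]] Pn0.
  rewrite size_map -cardE -/h ltnNge sP => H; apply: H.
    apply/allP => _ /imageP [p cp ->].
    rewrite rootE horner_sum; have /rowP/(_ p) := vM.
    rewrite !mxE => vMp; apply/eqP; rewrite -[RHS]vMp [LHS]big_mkcond.
    apply: eq_bigr => q _; rewrite !mxE hornerZ hornerXn.
    by rewrite -(eqP cp) eq_sym; case: eqP => _; rewrite ?mul1r ?mul0r ?mulr0.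
  rewrite map_inj_in_uniq ?enum_uniq // => p q; rewrite !mem_enum !inE.
  by move=> /eqP cp /eqP cq; apply: y_inj; rewrite cp cq.
have : P`_(row q0) = v 0 q0.
  rewrite coef_sum (bigD1 q0) //= coefZ coefXn eqxx mulr1 big1 ?addr0 // => q.
  case/andP=> /eqP cq qq0; rewrite coefZ coefXn.
  case: eqP => [e|_]; last by rewrite mulr0.
  case/eqP: qq0; apply: (col_row_inj row_inc cq); exact/esym/val_inj.
by rewrite P0 coef0.
Qed.

(** * Doubling the columns of a tableau *)

Section Doubling.
Variables (T : eqType) (d M : nat) (col : 'I_M -> T) (row : 'I_M -> 'I_d).

Definition half_pos (p : 'I_(M + M)) : 'I_M :=
  match split p with inl q => q | inr q => q end.

(** The boolean separates the two copies of a column, so that the matrix of the doubled tableau is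
    block diagonal. *)
Definition dcol (p : 'I_(M + M)) : bool * T :=
  match split p with inl q => (false, col q) | inr q => (true, col q) end.

Definition drow (p : 'I_(M + M)) : 'I_d := row (half_pos p).

Lemma split_lshift (q : 'I_M) : split (lshift M q) = inl q.
Proof. exact: (unsplitK (inl q)). Qed.

Lemma split_rshift (q : 'I_M) : split (rshift M q) = inr q.
Proof. exact: (unsplitK (inr q)). Qed.

Lemma half_lshift q : half_pos (lshift M q) = q.
Proof. by rewrite /half_pos split_lshift. Qed.

Lemma half_rshift q : half_pos (rshift M q) = q.
Proof. by rewrite /half_pos split_rshift. Qed.

Lemma dcol_lshift q : dcol (lshift M q) = (false, col q).
Proof. by rewrite /dcol split_lshift. Qed.

Lemma dcol_rshift q : dcol (rshift M q) = (true, col q).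
Proof. by rewrite /dcol split_rshift. Qed.

Definition double_simpl := (half_lshift, half_rshift, dcol_lshift, dcol_rshift).

Lemma drow_inc :
  (forall p q : 'I_M, (p < q)%N -> col p = col q -> (row p < row q)%N) ->
  forall p q : 'I_(M + M), (p < q)%N -> dcol p = dcol q -> (drow p < drow q)%N.
Proof.
move=> row_inc p q; rewrite /drow -(splitK p) -(splitK q).
case: (split p) (split q) => {}p [] {}q /= pq; rewrite !double_simpl => -[] // c.
  exact: row_inc.
by apply: row_inc => //; move: pq; rewrite /= ltn_add2l.
Qed.

Lemma drow_down :
  (forall p (l : 'I_d), (l <= row p)%N -> exists2 r, col r = col p & row r = l) ->
  forall p (l : 'I_d), (l <= drow p)%N -> exists2 r, dcol r = dcol p & drow r = l.
Proof.
move=> row_down p l; rewrite /drow -(splitK p).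
case: (split p) => {}p /=; rewrite !double_simpl => /row_down [r cr rr].
  by exists (lshift M r); rewrite !double_simpl ?cr.
by exists (rshift M r); rewrite !double_simpl ?cr.
Qed.

Lemma tabdet_double (C : comNzRingType) (Y : 'I_M -> 'I_d -> C) :
  tabdet dcol drow (fun p => Y (half_pos p)) = tabdet col row Y ^+ 2.
Proof.
pose B := \matrix_(p, q) ((col p == col q)%:R * Y p (row q)).
rewrite expr2 /tabdet -/B -(det_ublock B 0); congr (\det _).
apply/matrixP => p q; rewrite mxE /drow -(splitK p) -(splitK q).
case: (split p) (split q) => {}p [] {}q /=; rewrite !double_simpl xpair_eqE /=.
- by rewrite block_mxEul mxE.
- by rewrite block_mxEur mxE mul0r.
- by rewrite block_mxEdl mxE mul0r.
- by rewrite block_mxEdr mxE.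
Qed.

Lemma prod_double (C : comNzRingType) (F : 'I_d -> C) :
  \prod_p F (drow p) = (\prod_p F (row p)) ^+ 2.
Proof.
rewrite big_split_ord expr2 /drow; congr (_ * _); apply: eq_bigr => p _.
  by rewrite half_lshift.
by rewrite half_rshift.
Qed.

End Doubling.

(** * Boxes of a Young diagram *)

Section Boxes.

Definition conj_part (lam : seq nat) : seq nat :=
  [seq count (fun x => j < x)%N lam | j <- iota 0 (head 0 lam)].

(** Both sides say that the diagram has a box in row i and column j. *)
Lemma part_nth_lt (lam : seq nat) i j : sorted geq lam ->
  (i < count (fun x => j < x) lam)%N = (j < nth 0 lam i)%N.
Proof.
elim: lam i => [|x lam IH] i; first by rewrite nth_nil.
rewrite /= (path_sortedE (rev_trans leq_trans)) => /andP [/allP lex sl].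
case: (ltnP j x) => jx; first by case: i => [|i] //=; rewrite add1n ltnS IH.
have c0 : count (fun x => j < x)%N lam = 0.
  apply/eqP; rewrite -leqn0 leqNgt -has_count; apply/hasPn => z /lex zx.
  by rewrite -leqNgt (leq_trans zx).
rewrite c0; case: i => [|i] /=; first by rewrite [RHS]ltnNge jx.
by rewrite -IH // c0.
Qed.

(** The boxes are counted by columns and then by rows. Addition gives the size of the partition,
    multiplication the weight. *)
Lemma big_conj_part (R : Type) (idx : R) (op : Monoid.com_law idx)
    (F : nat -> R) (lam : seq nat) d : sorted geq lam -> (size lam <= d)%N ->
  \big[op/idx]_(h <- conj_part lam) \big[op/idx]_(i <- iota 0 h) F i =
  \big[op/idx]_(i < d) iterop (nth 0 lam i) op (F i) idx.
Proof.
move=> sl sd.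
have nth_le i : (nth 0 lam i <= head 0 lam)%N.
  rewrite -nth0; case: (ltnP i (size lam)) => [il|?]; last by rewrite nth_default.
  have := sorted_leq_nth (rev_trans leq_trans) leqnn 0 sl.
  by move=> /(_ 0 i); rewrite !inE il (leq_ltn_trans _ il) //; apply.
rewrite big_map.
transitivity (\big[op/idx]_(j <- iota 0 (head 0 lam))
   \big[op/idx]_(i < d | (j < nth 0 lam i)%N) F i).
  apply: eq_bigr => j _; rewrite -(big_mkord (fun i => j < nth 0 lam i)%N F).
  rewrite -[in LHS](subn0 (count _ _)) -/(index_iota 0 _).
  rewrite (big_nat_widen _ _ d); last by rewrite (leq_trans (count_size _ _)).
  by apply: eq_bigl => i; rewrite part_nth_lt.
rewrite (exchange_big_dep predT) //=; apply: eq_bigr => i _.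
rewrite -[X in iota 0 X]subn0 -/(index_iota 0 _).
rewrite -(big_nat_widen 0 _ _ xpredT (fun=> F i)) //.
by rewrite big_const_nat subn0 Monoid.iteropE.
Qed.

Lemma sumn_conj_part lam : sorted geq lam -> sumn (conj_part lam) = sumn lam.
Proof.
move=> sl; have := @big_conj_part _ _ addn (fun=> 1) lam (size lam) sl (leqnn _).
under eq_bigr => h _ do rewrite sum1_size size_iota.
rewrite !sumnE => ->; rewrite [RHS](big_nth 0) big_mkord; apply: eq_bigr => i _.
by rewrite Monoid.iteropE /=; elim: (nth 0 lam i) => //= x ->.
Qed.

Lemma big_reshape_offset (R : Type) (idx : R) (op : Monoid.law idx)
    (F : nat -> R) (hs : seq nat) :
  \big[op/idx]_(p < sumn hs) F (reshape_offset hs p) =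
  \big[op/idx]_(h <- hs) \big[op/idx]_(i <- iota 0 h) F i.
Proof.
pose ss := [seq iota 0 h | h <- hs].
have sh : shape ss = hs.
  by rewrite /shape -map_comp -[RHS]map_id; apply: eq_map => h; rewrite /= size_iota.
have sz : size (flatten ss) = sumn hs by rewrite size_flatten sh.
rewrite -(big_map (iota 0) xpredT (fun s => \big[op/idx]_(i <- s) F i)) -/ss.
rewrite -big_flatten [RHS](big_nth 0) sz big_mkord.
apply: eq_bigr => p _; rewrite nth_flatten sh; congr F.
have pr := reshape_indexP (ltn_ord p).
by rewrite (nth_map 0) // nth_iota // reshape_offsetP.
Qed.

(* The boxes of lam are numbered column by column. A column has at most k
   boxes, so their numbers are distinct modulo k. *)
Lemma boxes_exist (k n d : nat) (lam : seq nat) :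
  (k <= d)%N -> sorted geq lam -> (size lam <= k)%N -> sumn lam = (k * n)%N ->
  exists (col : 'I_(k * n) -> nat) (row : 'I_(k * n) -> 'I_d),
  [/\ forall p q : 'I_(k * n), (p < q)%N -> col p = col q -> (row p < row q)%N,
      forall p (l : 'I_d), (l <= row p)%N -> exists2 r, col r = col p & row r = l,
      forall p q, col p = col q -> p = q %[mod k] -> p = q
    & forall (R : comNzRingType) (F : 'I_d -> R),
        \prod_p F (row p) = \prod_i F i ^+ nth 0 lam i].
Proof.
move=> kd sl sk sumlam; pose hs := conj_part lam.
have sumhs : sumn hs = (k * n)%N by rewrite sumn_conj_part.
have hk r : (nth 0 hs r <= k)%N.
  case: (ltnP r (size hs)) => [rs|?]; last by rewrite nth_default.
  move: rs; rewrite size_map size_iota => rs.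
  by rewrite (nth_map 0) ?size_iota // (leq_trans (count_size _ _)).
pose rw (p : nat) := reshape_offset hs p; pose cl (p : nat) := reshape_index hs p.
have rwk p : (p < k * n)%N -> (rw p < k)%N.
  by rewrite -sumhs => /reshape_offsetP ph; apply: leq_trans ph (hk _).
have rwd (p : 'I_(k * n)) : (rw p < d)%N by rewrite (leq_trans (rwk _ _)).
have pE p : p = (sumn (take (cl p) hs) + rw p)%N by rewrite [LHS](esym (reshape_indexK hs p)).
exists (fun p => cl p), (fun p => Ordinal (rwd p)); split => /=.
- by move=> p q; rewrite {1}(pE p) {1}(pE q) => + c; rewrite c ltn_add2l.
- move=> p l lp.
  have lh : (l < nth 0 hs (cl p))%N.
    by apply: leq_ltn_trans lp _; apply: reshape_offsetP; rewrite sumhs.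
  have rM : (flatten_index hs (cl p) l < k * n)%N by rewrite -[X in (_ < X)%N]sumhs flatten_indexP.
  exists (Ordinal rM); first by rewrite /cl /= flatten_indexKl.
  by apply: val_inj; rewrite /= /rw flatten_indexKr.
(* Boxes of one column differ only in their rows, which are less than k. *)
- move=> p q c; rewrite (pE p) (pE q) c => /eqP; rewrite eqn_modDl.
  rewrite !modn_small ?rwk // => /eqP r; apply: val_inj.
  by rewrite /= (pE p) (pE q) c r.
move=> R F.
(* [inord] needs a successor; for d = 0 there are no boxes. *)
case: d kd F rwd => [|d] kd F rwd.
  rewrite !big1 //; first by case.
  by move=> p; have := rwd p.
pose F' i := F (inord i).
have := big_reshape_offset *%R F' hs; rewrite (@big_conj_part _ _ _ _ _ d.+1) //; last first.
  exact: leq_trans kd.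
rewrite sumhs => E; transitivity (\prod_(p < k * n) F' (rw p)).
  by apply: eq_bigr => p _; congr F; apply: val_inj; rewrite /= inordK.
by rewrite E; apply: eq_bigr => i _; rewrite /F' inord_val.
Qed.

End Boxes.

(** * The plethysm *)

Section EvenPlethysm.
Variables (C : numClosedFieldType) (k n d : nat).
Local Notation M := (k * n)%N.
Local Notation W := (sym_power k (sym_power (2 * n) (std_rep C d))).
Local Notation word := {ffun 'I_k -> {ffun 'I_(2 * n) -> 'I_d}}.

Definition plethysm_frame := sym_frame (sym_frame (std_frame C d) (2 * n)) k.

Lemma plethysm_rational : rational_coefs W.
Proof.
apply: (frame_rational plethysm_frame) => J K.
by do 2!apply: ratfun_prod => ?; apply: ratfun_entry.
Qed.

Lemma plethysm_contravariant : exists h : W -> W -> C, contravariant_form h.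
Proof.
eexists; apply: (frame_contravariant plethysm_frame) => g J K.
rewrite /sym_coef rmorph_prod; apply: eq_bigr => a _.
by rewrite rmorph_prod; apply: eq_bigr => b _; rewrite !mxE.
Qed.

(** With [f1 j] the 2n-th power of the linear form [f0 j], take the k-th power of the sum of the
    [f1 j]; expanding it over the k factors produces the maps phi. *)
Lemma plethysm_functional (x : 'I_k -> 'I_d -> C) : exists f : 'Hom(W, C^o),
  forall J, f (frame_vec plethysm_frame J) =
    \sum_(phi : {ffun 'I_k -> 'I_k}) \prod_a \prod_b x (phi a) (J a b).
Proof.
pose f0 j := \sum_i x j i *: std_coord C i.
have f0E j i : f0 j (std_vec C i) = x j i.
  rewrite sum_lfunE (bigD1 i) //= big1 => [|l li]; rewrite scale_lfunE lfunE /=.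
    by rewrite addr0 /std_coord_fun mxE !eqxx; apply: mulr1.
  by rewrite /std_coord_fun mxE (negbTE li) scaler0.
have /choice [f1 f1E] j := sym_functional (std_frame C d) (2 * n) (f0 j).
have [f fE] := sym_functional (sym_frame (std_frame C d) (2 * n)) k (\sum_j f1 j).
exists f => J; rewrite fE.
under eq_bigr => a _.
  rewrite sum_lfunE; under eq_bigr do rewrite f1E; over.
rewrite bigA_distr_bigA; apply: eq_bigr => phi _.
by apply: eq_bigr => a _; apply: eq_bigr => b _; rewrite f0E.
Qed.

Lemma pos_mod (p : 'I_M) : (p %% k < k)%N.
Proof.
have := leq_ltn_trans (leq0n p) (ltn_ord p).
by rewrite ltn_mod muln_gt0 => /andP [].
Qed.

Lemma pos_div (p : 'I_M) : (p %/ k < n)%N.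
Proof. by rewrite ltn_divLR ?(leq_ltn_trans _ (pos_mod p)) // [X in (_ < X)%N]mulnC. Qed.

Definition block_of (p : 'I_M) : 'I_k := Ordinal (pos_mod p).

Lemma place_subproof (p : 'I_(M + M)) :
  ((if split p then 0 else n) + half_pos p %/ k < 2 * n)%N.
Proof.
rewrite mul2n -addnn; have := pos_div (half_pos p).
case: (split p) => q lt; last by rewrite ltn_add2l.
exact: leq_trans lt (leq_addr _ _).
Qed.

(** The entry in a box, counted from 0, names a factor of the outer power. The n boxes with this
    entry in the first copy take the first n inner places, those in the second copy the last n. *)
Definition place (p : 'I_(M + M)) : 'I_k * 'I_(2 * n) :=
  (block_of (half_pos p), Ordinal (place_subproof p)).

Lemma place_bij : bijective place.
Proof.
apply: inj_card_bij; last first.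
  by rewrite card_prod !card_ord mul2n -addnn mulnDr.
have pE (p q : 'I_M) : (p %% k = q %% k)%N -> (p %/ k = q %/ k)%N -> p = q.
  by move=> em ed; apply: val_inj; rewrite /= (divn_eq p k) (divn_eq q k) em ed.
move=> p q [] em ed; move: em ed; rewrite -(splitK p) -(splitK q).
case: (split p) (split q) => {}p [] {}q /=;
  rewrite !(half_lshift, half_rshift, split_lshift, split_rshift) /= => em.
- by move=> ed; rewrite (pE p q).
- by move=> ed; have := pos_div p; rewrite -[(p %/ k)%N]add0n ed ltnNge leq_addr.
- by move=> ed; have := pos_div q; rewrite -[(q %/ k)%N]add0n -ed ltnNge leq_addr.
- by move=> /addnI ed; rewrite (pE p q).
Qed.

Lemma plethysm_weight_vector (lam : seq nat) : (k <= d)%N ->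
  sorted geq lam -> (size lam <= k)%N -> sumn lam = M ->
  exists w : W, highest_weight_vector (double_weight d lam) w.
Proof.
move=> kd sl sk sumlam.
have [col [row [row_inc row_down block_inj prod_row]]] :=
  boxes_exist kd sl sk sumlam.
pose S (J : word) : C :=
  tabdet (dcol col) (drow row) (fun p i => (J (place p).1 (place p).2 == i)%:R).
exists (\sum_J S J *: frame_vec plethysm_frame J); split; last first.
  (* By multilinearity the new coefficient at K is a determinant with rows taken from g;
     triangularity splits it into S K and the product of g i i over the doubled boxes. *)
  move=> g gU gup; rewrite frame_comb_act // scaler_sumr.
  apply: eq_bigr => K _; rewrite scalerA; congr (_ *: _).
  rewrite (tabdet_multilinear _ _ (fun ab i => g (K ab.1 ab.2) i) place_bij).
  rewrite (tabdet_triangular (drow_inc row_inc) (drow_down row_down)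
             (fun p => K (place p).1 (place p).2)) //.
  rewrite -/(S K) mulrC; congr (_ * _).
  rewrite (prod_double row (fun i => g i i)) (prod_row C (fun i => g i i)) -prodrXl.
  by apply: eq_bigr => i _; rewrite -exprM mulnC /double_weight.
(* The points 0, ..., k - 1 on the moment curve, with 0 ^+ 0 = 1. They are real, so every [D phi] is
   real and no squares cancel. *)
pose x (j : 'I_k) (i : 'I_d) : C := j%:R ^+ i.
have [f fE] := plethysm_functional x.
pose D (phi : {ffun 'I_k -> 'I_k}) : C :=
  tabdet col row (fun p => x (phi (block_of p))).
have fw : f (\sum_J S J *: frame_vec plethysm_frame J) = \sum_phi D phi ^+ 2.
  transitivity (\sum_J S J * f (frame_vec plethysm_frame J)).
    by rewrite linear_sum; apply: eq_bigr => J _; rewrite linearZ.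
  under eq_bigr => J _ do rewrite fE mulr_sumr.
  rewrite exchange_big; apply: eq_bigr => phi _ /=.
  (* Both copies of a box lie in the same block, so the row depends on [half_pos p] alone and the
     determinant is a square. *)
  rewrite -tabdet_double.
  exact: (tabdet_multilinear _ _ (fun ab => x (phi ab.1)) place_bij).
have D_real phi : D phi \is Num.real.
  apply: rpred_sum => s _; rewrite realM ?rpredX ?rpredN ?rpred1 //.
  by apply: rpred_prod => p _; rewrite !mxE realM ?realn ?rpredX ?realn.
have D_ge0 phi : true -> 0 <= D phi ^+ 2 by rewrite real_exprn_even_ge0.
move=> w0; move: fw; rewrite w0 linear0 => /esym/eqP.
rewrite psumr_eq0 // => /allP /(_ [ffun j => j] (mem_index_enum _)).
rewrite /= expf_eq0 /=; apply/negP.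
have -> : D [ffun j => j] = tabdet col row (fun p i => (block_of p)%:R ^+ i).
  by apply: eq_tabdet => p i; rewrite /x ffunE.
apply: tabdet_Vandermonde_neq0 => // p q cpq /eqP.
by rewrite eqr_nat => /eqP; apply: block_inj.
Qed.

Lemma plethysm_irreducible (lam : seq nat) : (k <= d)%N ->
  sorted geq lam -> (size lam <= k)%N -> sumn lam = M ->
  exists (U : {vspace W}) (sU : glstable U),
    irreducible_of_highest_weight (double_weight d lam) (subrep sU).
Proof.
move=> kd sl sk sumlam.
have [w wmu] := plethysm_weight_vector kd sl sk sumlam.
have [h hW] := plethysm_contravariant.
exact: highest_weight_submodule plethysm_rational hW wmu.
Qed.

End EvenPlethysm.

Theorem mainTheorem1 (R : realType) (k n d : nat) (hkd : (k <= d)%N)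
    (lam : seq nat) (hlam : is_partition lam) (hsize : (size lam <= k)%N)
    (hsum : sumn lam = (k * n)%N) :
  (exists V : glrep R[i] d,
      irreducible_of_highest_weight (double_weight d lam) V) /\
  (forall V : glrep R[i] d,
      irreducible_of_highest_weight (double_weight d lam) V ->
      occurs_in V (sym_power k (sym_power (2 * n) (std_rep R[i] d)))).
Proof.
have /andP [sl _] := hlam.
have [U [sU Uirr]] := @plethysm_irreducible R[i] k n d lam hkd sl hsize hsum.
(* The submodule [U] is itself a model, and every other model is isomorphic to it. *)
split=> [|V [/rational_coefsP Vrat Virr [v vmu]]]; first by exists (subrep sU).
case: Uirr => /rational_coefsP Urat Uirr [u umu].
by exists U, sU; apply: irreducible_iso vmu Urat Uirr umu.
Qed.
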